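(* Let $\mathcal N$ be a von Neumann algebra and let $G$ be a discrete group acting on $\mathcal N$ by properly outer automorphisms $\alpha$ (that is, $\alpha_g$ is properly outer for every $g\ne e$). Let $\mathcal M=\mathcal N\rtimes_\alpha G$ be the von Neumann algebra crossed product. Then $(\mathcal M,\mathcal N,\mathcal Z(\mathcal N))$ is a Cartan triple if and only if the action of $G$ restricted to the center $\mathcal Z(\mathcal N)$ is properly outer.
   Context: An automorphism $\alpha$ of a von Neumann algebra $\mathcal N$ is properly outer if there is no nonzero central projection $z\in\mathcal Z(\mathcal N)$ such that $\alpha|_{\mathcal Nz}$ is inner; equivalently, if $x\in\mathcal N$ and $yx=x\alpha(y)$ for all $y\in\mathcal N$, then $x=0$. The action of $G$ restricted to $\mathcal Z(\mathcal N)$ is properly outer if $\alpha_g|_{\mathcal Z(\mathcal N)}$ is a properly outer automorphism of $\mathcal Z(\mathcal N)$ for every $g\ne e$. For von Neumann algebras $\mathcal L\subseteq\mathcal M$, put $\mathcal{GN}(\mathcal M,\mathcal L)=\{v\in\mathcal M: v\text{ is a partial isometry and } v^*\mathcal Lv\cup v\mathcal Lv^*\subseteq\mathcal L\}$; $\mathcal L$ is regular in $\mathcal M$ if the linear span of $\mathcal{GN}(\mathcal M,\mathcal L)$ is weak-$*$ dense in $\mathcal M$. A Cartan triple $(\mathcal M,\mathcal N,\mathcal D)$ consists of von Neumann algebras such that (1) $\mathcal D$ is an abelian and regular von Neumann subalgebra of $\mathcal M$; (2) $\mathcal N$ is the relative commutant of $\mathcal D$ in $\mathcal M$; (3) there exists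 a faithful normal conditional expectation $E:\mathcal M\to\mathcal N$. In $\mathcal N\rtimes_\alpha G$, $\mathcal N$ is identified with its canonical copy. *)

(* Defs.v *)
From HB Require Import structures.
From mathcomp Require Import all_boot all_order all_algebra.
From mathcomp Require Import finmap complex.
From mathcomp Require Import all_classical all_reals topology normedtype.
From mathcomp Require Import analysis.showcase.summability.
From mathcomp Require Import ring.

Set Implicit Arguments.
Unset Strict Implicit.
Unset Printing Implicit Defensive.

Import Order.TTheory GRing.Theory Num.Theory.
Import numFieldNormedType.Exports.

Local Open Scope classical_set_scope.
Local Open Scope ring_scope.

(* Complex Hilbert spaces; the inner product is linear in its first argument. *)
HB.mixin Record isHilbert (R : realType) H of CompleteNormedModule R[i] H := {
  inner : H -> H -> R[i];
  innerPl : forall (a : R[i]) x y z,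
    inner (a *: x + y) z = a * inner x z + inner y z;
  innerC : forall x y, inner y x = (inner x y)^*;
  innerxx : forall x, inner x x = `|x| ^+ 2 }.

#[short(type="hilbertType")]
HB.structure Definition Hilbert (R : realType) :=
  {H of CompleteNormedModule R[i] H & isHilbert R H}.

Section inner_theory.
Variables (R : realType) (H : hilbertType R).
Implicit Types x y z : H.

Lemma innerDl x y z : inner (x + y) z = inner x z + inner y z.
Proof. by rewrite -[x]scale1r innerPl scale1r mul1r. Qed.

Lemma inner0l z : inner (0 : H) z = 0.
Proof. by apply: (addrI (inner 0 z)); rewrite -innerDl !addr0. Qed.

Lemma innerZl a x z : inner (a *: x) z = a * inner x z.
Proof. by rewrite -[a *: x]addr0 innerPl inner0l addr0. Qed.

Lemma innerDr x y z : inner z (x + y) = inner z x + inner z y.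
Proof. by rewrite innerC innerDl rmorphD /= -!innerC. Qed.

Lemma innerZr a x z : inner z (a *: x) = a^* * inner z x.
Proof. by rewrite innerC innerZl rmorphM /= -innerC. Qed.

Lemma inner_polar x y : inner x y = 4^-1 *
  (`|x + y| ^+ 2 - `|x - y| ^+ 2
   + 'i * `|x + 'i *: y| ^+ 2 - 'i * `|x - 'i *: y| ^+ 2).
Proof.
have e (a : R[i]) : `|x + a *: y| ^+ 2 =
    `|x| ^+ 2 + a^* * inner x y + a * inner y x + a * a^* * `|y| ^+ 2.
  by rewrite -!innerxx innerDl !innerDr !innerZl !innerZr; ring.
have e1 := e 1; have e2 := e (-1); have e3 := e 'i; have e4 := e (- 'i).
rewrite scale1r rmorph1 in e1; rewrite scaleN1r rmorphN1 in e2.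
rewrite conjCi in e3; rewrite scaleNr rmorphN /= conjCi in e4.
rewrite e1 e2 e3 e4.
have i2 : 'i * 'i = -1 :> R[i] by rewrite -expr2 sqrCi.
apply: (@mulfI _ 4); first by rewrite pnatr_eq0.
rewrite mulrA mulfV ?pnatr_eq0// mul1r.
transitivity (2 * inner x y + 2 * inner y x
  - 2 * ('i * 'i) * inner x y + 2 * ('i * 'i) * inner y x).
  by rewrite i2; ring.
by ring.
Qed.
End inner_theory.

#[global] Existing Instance totally_filter.

Section sums.
Variables (R : realType) (I : choiceType).
Implicit Types u v : I -> R[i]^o.

Lemma partial_sumE u (J : {fset I}) : partial_sum u J = \sum_(i <- J) u i.
Proof. by rewrite /partial_sum [RHS]big_seq_fsetE. Qed.

Lemma sum_ge0_lub u (M : R[i]) : (forall i, 0 <= u i) ->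
  (forall J : {fset I}, \sum_(i <- J) u i <= M) ->
  exists S : R[i]^o, [/\ partial_sum u J @[J --> totally] --> S,
    forall J : {fset I}, \sum_(i <- J) u i <= S &
    forall M' : R[i], (forall J : {fset I}, \sum_(i <- J) u i <= M') ->
      S <= M'].
Proof.
move=> u0 uM.
have s0 J : 0 <= \sum_(i <- J) u i :> R[i] by exact: sumr_ge0.
pose s (J : {fset I}) := complex.Re (\sum_(i <- J) u i : R[i]).
have sE J : (s J)%:C%C = \sum_(i <- J) u i :> R[i].
  by rewrite RRe_real // ger0_real.
pose A := [set s J | J in [set: {fset I}]].
have A0 : A !=set0 by exists (s fset0); exists fset0.
have leC (a b : R) : (a%:C%C <= b%:C%C :> R[i]) = (a <= b) by rewrite lecR.
have bnd (M' : R[i]) : (forall J : {fset I}, \sum_(i <- J) u i <= M') ->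
    exists2 m, M' = m%:C%C & ubound A m.
  move=> uM'; have M'0 : 0 <= M' := le_trans (s0 fset0) (uM' fset0).
  have M'E : M' = (complex.Re M')%:C%C by rewrite RRe_real // ger0_real.
  exists (complex.Re M') => // _ [J _ <-].
  by rewrite -leC -M'E sE.
have supA : has_sup A by split=> //; have [m _ ?] := bnd _ uM; exists m.
have sS J : s J <= sup A by apply: (sup_upper_bound supA); exists J.
exists (sup A)%:C%C; split.
- apply/cvgrPdist_lt => e e0.
  have eE : e = (complex.Re e)%:C%C by rewrite RRe_real // gtr0_real.
  have e1 : 0 < complex.Re e by rewrite -ltcR -eE.
  have [_ [J _ <-] Je] := sup_adherent e1 supA.
  exists J => // J' /= JJ'.
  rewrite partial_sumE -sE -rmorphB /= ger0_norm ?ler0c ?subr_ge0 // eE ltcR.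
  rewrite ltrBlDl -ltrBlDr (lt_le_trans Je)// -leC !sE.
  rewrite [leRHS](big_fsetID _ (mem J)) /=.
  have -> : [fset x in J' | x \in J]%fset = J.
    apply/fsetP => x; rewrite !inE /=; case: (boolP (x \in J)) => // xJ.
      by rewrite (fsubsetP JJ').
    by rewrite andbF.
  by rewrite lerDl; exact: sumr_ge0.
- by move=> J; rewrite -sE leC.
- move=> M' /bnd[m -> mA]; rewrite leC; exact: ge_sup.
Qed.

End sums.

Section l2_def.
Variables (R : realType) (I : choiceType) (H : hilbertType R).

(* The Hilbert space l2(I, H) of square-summable families of vectors of H. *)
Definition square_summable : {pred I -> H} := fun f =>
  `[< exists M : R[i],
      forall J : {fset I}, \sum_(i <- J) `|f i| ^+ 2 <= M >].

Record l2 := L2 { l2_fun :> I -> H; l2P : l2_fun \in square_summable }.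

HB.instance Definition _ := [isSub for l2_fun].
HB.instance Definition _ := [Choice of l2 by <:].

Lemma square_summable_submod_closed : submod_closed square_summable.
Proof.
split=> [|a f g].
  by apply/asboolP; exists 0 => J; rewrite big1// => i _; rewrite normr0 expr0n.
move=> /asboolP[M fM] /asboolP[N gN]; apply/asboolP.
exists (2 * `|a| ^+ 2 * M + 2 * N) => J.
apply: (@le_trans _ _ (2 * `|a| ^+ 2 * \sum_(i <- J) `|f i| ^+ 2
                     + 2 * \sum_(i <- J) `|g i| ^+ 2)); last first.
  by apply: lerD; rewrite ler_wpM2l// mulr_ge0// exprn_ge0.
rewrite !mulr_sumr -big_split /=; apply: ler_sum => i _.
have h : `|a *: f i + g i| <= `|a| * `|f i| + `|g i|.
  by rewrite -normrZ ler_normD.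
apply: (@le_trans _ _ ((`|a| * `|f i| + `|g i|) ^+ 2)).
  by apply: lerXn2r => //; rewrite nnegrE ?addr_ge0 ?mulr_ge0.
rewrite -subr_ge0 [X in 0 <= X](_ : _ = (`|a| * `|f i| - `|g i|) ^+ 2).
  by rewrite real_exprn_even_ge0// rpredB// ger0_real ?mulr_ge0.
by ring.
Qed.

HB.instance Definition _ :=
  GRing.isSubmodClosed.Build _ _ square_summable square_summable_submod_closed.
HB.instance Definition _ := [SubChoice_isSubLmodule of l2 by <:].

Implicit Types (a : R[i]) (f g h : l2).

Lemma l2DE (f g : l2) i : (f + g) i = f i + g i. Proof. by []. Qed.
Lemma l2BE (f g : l2) i : (f - g) i = f i - g i. Proof. by []. Qed.
Lemma l2ZE a (f : l2) i : (a *: f) i = a *: f i. Proof. by []. Qed.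

Definition l2inner (f g : l2) : R[i] :=
  sum (fun i => inner (f i) (g i) : R[i]^o).

Definition l2norm (f : l2) : R[i] := sqrtC (l2inner f f).

Lemma l2_lub (f : l2) :
  exists S : R[i]^o,
    [/\ partial_sum (fun i => `|f i| ^+ 2 : R[i]^o) J @[J --> totally] --> S,
    forall J : {fset I}, \sum_(i <- J) `|f i| ^+ 2 <= S &
    forall M' : R[i], (forall J : {fset I}, \sum_(i <- J) `|f i| ^+ 2 <= M') ->
      S <= M'].
Proof.
have /asboolP[M fM] := l2P f.
by apply: (sum_ge0_lub _ fM) => i; rewrite exprn_ge0.
Qed.

Lemma cvg_eqfun (T : Type) (F : set_system T) (u v : T -> R[i]^o)
  (x : R[i]^o) : u @ F --> x -> u =1 v -> v @ F --> x.
Proof. by move=> ux /funext <-. Qed.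

Lemma cvg_comb (T : Type) (F : set_system T) {FF : Filter F}
    (a : R[i]) (u v : T -> R[i]) (x y : R[i]) :
  (u t : R[i]^o) @[t --> F] --> (x : R[i]^o) ->
  (v t : R[i]^o) @[t --> F] --> (y : R[i]^o) ->
  (a * u t + v t : R[i]^o) @[t --> F] --> (a * x + y : R[i]^o).
Proof. by move=> ux vy; exact: cvgD (cvgZl_tmp (k := a) ux) vy. Qed.
Arguments cvg_comb {T F FF} a {u v x y}.

Lemma l2inner_cvg f g :
  partial_sum (fun i => inner (f i) (g i) : R[i]^o) J @[J --> totally] -->
  (l2inner f g : R[i]^o).
Proof.
have [S1 [S1l _ _]] := l2_lub (f + g); have [S2 [S2l _ _]] := l2_lub (f - g).
have [S3 [S3l _ _]] := l2_lub (f + 'i *: g).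
have [S4 [S4l _ _]] := l2_lub (f - 'i *: g).
have [S h] : exists S : R[i]^o,
    partial_sum (fun i => inner (f i) (g i) : R[i]^o) J @[J --> totally] --> S.
  eexists; apply: cvg_eqfun.
    apply: (cvg_comb 4^-1 S1l); apply: (cvg_comb (- 4^-1) S2l).
    apply: (cvg_comb (4^-1 * 'i) S3l); apply: (cvg_comb (- (4^-1 * 'i)) S4l).
    exact: (cvg_cst (0 : R[i]^o)).
  move=> J; rewrite !partial_sumE !mulr_sumr addr0 -!big_split.
  by apply: eq_bigr => i _; rewrite inner_polar /=; ring.
have -> : l2inner f g = S by apply: cvg_lim h; exact: norm_hausdorff.
exact: h.
Qed.

Lemma l2inner_eq f g (S : R[i]^o) :
  partial_sum (fun i => inner (f i) (g i) : R[i]^o) J @[J --> totally] --> S ->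
  l2inner f g = S.
Proof. by move=> /cvg_lim; apply; exact: norm_hausdorff. Qed.

Lemma l2innerPl (a : R[i]) f g h :
  l2inner (a *: f + g) h = a * l2inner f h + l2inner g h.
Proof.
apply: l2inner_eq.
apply: cvg_eqfun.
  by apply: (cvg_comb a (@l2inner_cvg f h)); exact: l2inner_cvg.
move=> J; rewrite !partial_sumE mulr_sumr -big_split /=.
by apply: eq_bigr => i _; rewrite innerPl.
Qed.

Lemma l2innerC f g : l2inner g f = (l2inner f g)^*.
Proof.
apply: l2inner_eq; apply/cvgrPdist_lt => e e0.
have /cvgrPdist_lt/(_ _ e0) := @l2inner_cvg f g; apply: filterS => J.
suff -> : partial_sum (fun i => inner (g i) (f i) : R[i]^o) J =
   (partial_sum (fun i => inner (f i) (g i) : R[i]^o) J)^*.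
  by rewrite -rmorphB norm_conjC.
rewrite !partial_sumE rmorph_sum; apply: eq_bigr => i _; exact: innerC.
Qed.

Lemma l2innerDl f g h : l2inner (f + g) h = l2inner f h + l2inner g h.
Proof. by rewrite -[f]scale1r l2innerPl scale1r mul1r. Qed.

Lemma l2inner0l h : l2inner 0 h = 0.
Proof. by apply: (addrI (l2inner 0 h)); rewrite -l2innerDl !addr0. Qed.

Lemma l2innerZl a f h : l2inner (a *: f) h = a * l2inner f h.
Proof. by rewrite -[a *: f]addr0 l2innerPl l2inner0l addr0. Qed.

Lemma l2innerDr f g h : l2inner h (f + g) = l2inner h f + l2inner h g.
Proof. by rewrite l2innerC l2innerDl rmorphD /= -!l2innerC. Qed.

Lemma l2innerZr a f h : l2inner h (a *: f) = a^* * l2inner h f.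
Proof. by rewrite l2innerC l2innerZl rmorphM /= -l2innerC. Qed.

Lemma l2inner_lub f :
  (forall J : {fset I}, \sum_(i <- J) `|f i| ^+ 2 <= l2inner f f) /\
  (forall M : R[i], (forall J : {fset I}, \sum_(i <- J) `|f i| ^+ 2 <= M) ->
     l2inner f f <= M).
Proof.
have [S [Sl S1 S2]] := l2_lub f.
suff -> : l2inner f f = S by [].
apply: l2inner_eq; apply: (cvg_eqfun Sl) => J.
by rewrite !partial_sumE; apply: eq_bigr => i; rewrite innerxx.
Qed.

Lemma l2inner_ge0 f : 0 <= l2inner f f.
Proof. by have [/(_ fset0) h _] := l2inner_lub f; rewrite big_seq_fset0 in h. Qed.

Lemma l2norm_sqr f : l2norm f ^+ 2 = l2inner f f.
Proof. by rewrite /l2norm sqrtCK. Qed.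

Lemma l2norm_ge0 f : 0 <= l2norm f.
Proof. by rewrite /l2norm sqrtC_ge0 l2inner_ge0. Qed.

Lemma l2norm_le f (M : R[i]) : 0 <= M ->
  (forall J : {fset I}, \sum_(i <- J) `|f i| ^+ 2 <= M ^+ 2) -> l2norm f <= M.
Proof.
move=> M0 fM; rewrite -(@ler_pXn2r _ 2) ?nnegrE ?l2norm_ge0// l2norm_sqr.
by have [_ ->] := l2inner_lub f.
Qed.

Lemma l2norm_ge (f : l2) i : `|f i| <= l2norm f.
Proof.
rewrite -(@ler_pXn2r _ 2) ?nnegrE ?l2norm_ge0// l2norm_sqr.
by have [/(_ [fset i]%fset) h _] := l2inner_lub f; rewrite big_seq_fset1 in h.
Qed.

Lemma l2norm0_eq0 f : l2norm f = 0 -> f = 0.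
Proof.
move=> f0; apply/val_inj/funext => i /=; apply/eqP; rewrite -normr_le0 -f0.
exact: l2norm_ge.
Qed.

Lemma l2normZ a f : l2norm (a *: f) = `|a| * l2norm f.
Proof.
apply: (@pexpIrn _ 2) => //; rewrite ?nnegrE ?mulr_ge0 ?l2norm_ge0//.
by rewrite exprMn !l2norm_sqr l2innerZl l2innerZr mulrA -normCK.
Qed.

Lemma l2_CauchySchwarz f g : `|l2inner f g| <= l2norm f * l2norm g.
Proof.
have [g0|gn0] := eqVneq (l2norm g) 0.
  by rewrite g0 mulr0 (l2norm0_eq0 g0) l2innerC l2inner0l rmorph0 normr0.
have gg0 : 0 < l2inner g g.
  by rewrite -l2norm_sqr exprn_gt0// lt_def gn0 l2norm_ge0.
rewrite -(@ler_pXn2r _ 2) ?nnegrE ?mulr_ge0 ?l2norm_ge0//.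
rewrite exprMn !l2norm_sqr normCK.
set c := - (l2inner f g / l2inner g g).
have := l2inner_ge0 (c *: g + f).
rewrite l2innerDl !l2innerDr !l2innerZl !l2innerZr.
have ww : (l2inner g g)^* = l2inner g g by rewrite -l2innerC.
rewrite /c rmorphN rmorphM fmorphV /= ww [l2inner g f]l2innerC.
set p := l2inner f g; set q := p^*; set u := l2inner f f.
set w := l2inner g g in gg0 *.
have wn0 : w != 0 by rewrite gt_eqF.
rewrite [X in 0 <= X -> _](_ : _ = (u * w - p * q) / w); last first.
  by field.
by rewrite pmulr_lge0 ?invr_gt0// subr_ge0.
Qed.

Lemma l2normD f g : l2norm (f + g) <= l2norm f + l2norm g.
Proof.
rewrite -(@ler_pXn2r _ 2) ?nnegrE ?addr_ge0 ?l2norm_ge0//.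
rewrite l2norm_sqr l2innerDl !l2innerDr sqrrD !l2norm_sqr.
rewrite [l2inner g f]l2innerC.
have zc := l2_CauchySchwarz f g; set z := l2inner f g in zc *.
rewrite [leLHS](_ : _ = l2inner f f + (z + z^*) + l2inner g g); last by ring.
rewrite lerD2r lerD2l.
have zz : z + z^* <= `|z| *+ 2.
  have [h _] := leif_normC_Re_Creal z.
  rewrite -mulr_natr -ler_pdivrMr ?ltr0n// -ReE (le_trans _ h)//.
  by rewrite real_ler_norm// Creal_Re.
by rewrite (le_trans zz)// lerMn2r.
Qed.

HB.instance Definition _ := Lmodule_isNormed.Build R[i] l2 l2normD l2normZ
  l2norm0_eq0.

Lemma l2_complete (F : set_system l2) : ProperFilter F -> cauchy F -> cvg F.
Proof.
move=> FF Fc.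
have Fe (e : R[i]) : 0 < e ->
    exists2 A, F A & forall f g, A f -> A g -> `|f - g| < e.
  move=> e0; have /cauchy_ballP := Fc.
  move=> /(_ e e0)[[A B] /= [FA FB] AB]; exists (A `&` B); first exact: filterI.
  move=> f g [Af _] [_ Bg].
  by have := AB (f, g) (conj Af Bg); rewrite -ball_normE.
have ev i : cvg ((fun f : l2 => f i) @ F).
  apply: cauchy_cvg; apply/cauchy_ballP => e e0.
  have [A FA Ae] := Fe e e0.
  exists ((fun f : l2 => f i) @` A, (fun f : l2 => f i) @` A) => /=.
    have FB : F [set f | exists2 g : l2, A g & g i = f i].
      by apply: filterS FA => f Af; exists f.
    by split; exact: FB.
  move=> [_ _] /= [[f Af <-] [g Ag <-]]; rewrite -ball_normE /=.
  exact: le_lt_trans (l2norm_ge (f - g) i) (Ae _ _ Af Ag).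
pose v i := lim ((fun f : l2 => f i) @ F).
have vF i d : 0 < d -> F [set g : l2 | `|v i - g i| < d].
  by move=> d0; have /cvgrPdist_lt/(_ d d0) := ev i.
have vJ (s : seq I) d : 0 < d ->
    F [set g : l2 | forall i, i \in s -> `|v i - g i| < d].
  move=> d0; elim: s => [|i s IH]; first by apply: filterE.
  have := vF i d d0; move: IH; apply: filterS2 => g IH ig j.
  by rewrite inE => /predU1P[->//|]; exact: IH.
have key (e : R[i]) A : 0 < e -> F A ->
    (forall f g, A f -> A g -> `|f - g| < e) -> forall f, A f ->
    forall J : {fset I}, \sum_(i <- J) `|f i - v i| ^+ 2 <= (2 * e) ^+ 2.
  move=> e0 FA Ae f Af J.
  pose d := e / (size J).+1%:R.
  have d0 : 0 < d by rewrite divr_gt0// ltr0n.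
  have [g [Ag gJ]] := filter_ex (filterI FA (vJ J d d0)).
  have fg : \sum_(i <- J) `|f i - g i| ^+ 2 <= e ^+ 2.
    have [h _] := l2inner_lub (f - g).
    apply: (le_trans (h J)); rewrite -l2norm_sqr.
    by rewrite lerXn2r ?nnegrE ?l2norm_ge0 1?ltW// Ae.
  have gv : \sum_(i <- J) `|v i - g i| ^+ 2 <= e ^+ 2.
    apply: (@le_trans _ _ (\sum_(i <- J) d ^+ 2)).
      rewrite !big_seq; apply: ler_sum => i iJ.
      by rewrite lerXn2r ?nnegrE// ltW// gJ.
    rewrite big_const_seq count_predT iter_addr addr0 /d expr_div_n.
    rewrite -[_ *+ size J]mulr_natr -mulrA ler_piMr ?exprn_ge0 1?ltW//.
    rewrite mulrC ltr_pdivrMr ?exprn_gt0 ?ltr0n// mul1r -natrX ltr_nat.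
    by rewrite (leq_trans (ltnSn _))// leq_pmulr.
  apply: (@le_trans _ _ (2 * \sum_(i <- J) `|f i - g i| ^+ 2
      + 2 * \sum_(i <- J) `|v i - g i| ^+ 2)); last first.
    rewrite (_ : (2 * e) ^+ 2 = 2 * e ^+ 2 + 2 * e ^+ 2); last by ring.
    by rewrite lerD// ler_wpM2l.
  rewrite !mulr_sumr -big_split /=; apply: ler_sum => i _.
  have h : `|f i - v i| <= `|f i - g i| + `|v i - g i|.
    by rewrite [X in _ <= _ + X]distrC ler_distD.
  apply: (le_trans (lerXn2r 2 _ _ h)); rewrite ?nnegrE ?addr_ge0//.
  rewrite -subr_ge0 [X in 0 <= X](_ : _ = (`|f i - g i| - `|v i - g i|) ^+ 2).
    by rewrite real_exprn_even_ge0// rpredB// ger0_real.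
  by ring.
have vP : v \in square_summable.
  have [A FA Ae] := Fe 1 ltr01; have [f Af] := filter_ex FA.
  have h : (l2_fun f - v) \in square_summable.
    by apply/asboolP; exists ((2 * 1) ^+ 2) => J; exact: key ltr01 FA Ae f Af J.
  rewrite (_ : v = l2_fun f - (l2_fun f - v)); first exact: rpredB (l2P f) h.
  by rewrite subKr.
apply/cvg_ex; exists (L2 vP); apply/cvgrPdist_le => e e0.
have e20 : 0 < e / 2 by rewrite divr_gt0.
have [A FA Ae] := Fe _ e20; apply: (filterS _ FA) => f Af.
rewrite distrC; apply: l2norm_le; first exact: ltW.
move=> J; have := key _ A e20 FA Ae f Af J.
by rewrite mulrC divfK// pnatr_eq0.
Qed.

HB.instance Definition _ := Uniform_isComplete.Build l2 l2_complete.

HB.instance Definition _ := isHilbert.Build R l2 l2innerPl l2innerC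
  (fun f => esym (l2norm_sqr f)).

End l2_def.

Section bounded_operators.
Variables (R : realType) (H : hilbertType R).

Definition bounded_linear : {pred H -> H} := fun T =>
  `[< linear T /\ continuous T >].

Record bop := Bop { bop_fun :> H -> H; bopP : bop_fun \in bounded_linear }.

HB.instance Definition _ := [isSub for bop_fun].
HB.instance Definition _ := [Choice of bop by <:].

Lemma bounded_linear_submod_closed : submod_closed bounded_linear.
Proof.
split=> [|a S T].
  apply/asboolP; split=> [b x y|]; first by rewrite /= scaler0 addr0.
  exact: cst_continuous.
move=> /asboolP[Sl Sc] /asboolP[Tl Tc]; apply/asboolP; split=> [b x y|x].
  have E z : (a *: S + T) z = a *: S z + T z by [].
  by rewrite !E Sl Tl !scalerDr !scalerA mulrC addrACA.
by apply: cvgD (Tc x); apply: cvgZl_tmp; exact: Sc.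
Qed.

HB.instance Definition _ :=
  GRing.isSubmodClosed.Build _ _ bounded_linear bounded_linear_submod_closed.
HB.instance Definition _ := [SubChoice_isSubLmodule of bop by <:].

Lemma bop1_subproof : idfun \in bounded_linear.
Proof. by apply/asboolP; split=> [//|x]; exact: cvg_id. Qed.

Definition bop1 : bop := Bop bop1_subproof.

Lemma bopM_subproof (S T : bop) : S \o T \in bounded_linear.
Proof.
have /asboolP[Sl Sc] := bopP S; have /asboolP[Tl Tc] := bopP T.
apply/asboolP; split=> [a x y|x]; first by rewrite /= Tl Sl.
by apply: continuous_comp; [exact: Tc|exact: Sc].
Qed.

Definition bopM (S T : bop) : bop := Bop (bopM_subproof S T).

(* The adjoint exists, and is unique, by the Riesz representation theorem. *)
Definition adj (T : bop) : bop :=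
  xget 0 [set S : bop | forall x y, inner (T x) y = inner x (S y)].

Definition bop_le (S T : bop) : Prop := forall x, 0 <= inner ((T - S) x) x.

(* T |-> \sum_n <T (xi n), eta n> for square-summable sequences xi and eta:
   these functionals form the predual of B(H). *)
Definition normal_functional (p : l2 nat H * l2 nat H) (T : bop) : R[i]^o :=
  sum (fun n => inner (T (p.1 n)) (p.2 n) : R[i]^o).

(* B(H) with its weak-* (ultraweak) topology; the weak-* topology of a von
   Neumann algebra M in B(H) is the one induced on M. *)
Definition weakstar : topologicalType :=
  initial_topology
    ((fun T p => normal_functional p T) :
       bop -> {ptws l2 nat H * l2 nat H -> R[i]^o}).

Definition lin_span (A : set bop) : set bop :=
  [set x | exists n (c : 'I_n -> R[i]) (v : 'I_n -> bop),
     (forall i, A (v i)) /\ x = \sum_i c i *: v i].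

Definition commutant (A : set bop) : set bop :=
  [set T | forall S, A S -> bopM S T = bopM T S].

(* A self-adjoint set equal to its bicommutant: such a set is automatically a
   unital *-subalgebra of B(H), closed for the weak operator topology. *)
Definition von_neumann (N : set bop) : Prop :=
  (forall T, N T -> N (adj T)) /\ commutant (commutant N) = N.

Definition vn_center (N : set bop) : set bop := N `&` commutant N.

Definition relative_commutant (M D : set bop) : set bop := M `&` commutant D.

Definition abelian_algebra (D : set bop) : Prop :=
  forall S T, D S -> D T -> bopM S T = bopM T S.

Definition is_projection (p : bop) : Prop := bopM p p = p /\ adj p = p.

Definition is_partial_isometry (v : bop) : Prop :=
  bopM v (bopM (adj v) v) = v.

Definition groupoid_normalizer (M L : set bop) : set bop :=
  [set v | [/\ M v, is_partial_isometry v &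
     forall x, L x ->
       L (bopM (adj v) (bopM x v)) /\ L (bopM v (bopM x (adj v)))]].

Definition regular_in (M L : set bop) : Prop :=
  M `<=` closure (lin_span (groupoid_normalizer M L) : set weakstar).

(* Least upper bound for the operator order of B(H) restricted to M. *)
Definition is_sup_in (M A : set bop) (T : bop) : Prop :=
  [/\ M T, forall S, A S -> bop_le S T &
    forall U, M U -> (forall S, A S -> bop_le S U) -> bop_le T U].

Definition upward_directed (A : set bop) : Prop :=
  A !=set0 /\ forall S T, A S -> A T ->
    exists U, [/\ A U, bop_le S U & bop_le T U].

(* A positive N-bimodule projection of M onto N; by Tomiyama's theorem these are
   the projections of norm one. *)
Definition conditional_expectation (M N : set bop) (E : bop -> bop) : Prop :=
  [/\ forall x, M x -> N (E x),
      forall (a : R[i]) x y, M x -> M y -> E (a *: x + y) = a *: E x + E y,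
      forall x, M x -> bop_le 0 x -> bop_le 0 (E x),
      forall x, N x -> E x = x &
      forall a b x, N a -> N b -> M x ->
        E (bopM a (bopM x b)) = bopM a (bopM (E x) b)].

(* Normality in the order sense: E preserves the suprema of increasing nets of
   self-adjoint elements; bounded nets are exactly those with a supremum. *)
Definition normal_map (M N : set bop) (E : bop -> bop) : Prop :=
  forall (A : set bop) (T : bop), A `<=` M ->
    (forall S, A S -> adj S = S) -> upward_directed A ->
    is_sup_in M A T -> is_sup_in N (E @` A) (E T).

Definition faithful_map (M : set bop) (E : bop -> bop) : Prop :=
  forall x, M x -> E (bopM (adj x) x) = 0 -> x = 0.

Definition cartan_triple (M N D : set bop) : Prop :=
  [/\ [/\ von_neumann M, von_neumann N & von_neumann D],
      [/\ D `<=` M, abelian_algebra D & regular_in M D],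
      N = relative_commutant M D &
      exists E, [/\ conditional_expectation M N E, normal_map M N E &
                    faithful_map M E]].

(* The *-automorphisms of N; only the values of a on N matter, and normality is
   automatic. *)
Definition automorphism (N : set bop) (a : bop -> bop) : Prop :=
  [/\ set_bij N N a,
      forall (c : R[i]) x y, N x -> N y -> a (c *: x + y) = c *: a x + a y,
      forall x y, N x -> N y -> a (bopM x y) = bopM (a x) (a y) &
      forall x, N x -> a (adj x) = adj (a x)].

(* The restriction of a to the corner N z is Ad u for a unitary u of N z. *)
Definition inner_on_corner (N : set bop) (a : bop -> bop) (z : bop) : Prop :=
  exists u, [/\ N u, bopM (adj u) u = z, bopM u (adj u) = z &
    forall x, N x -> a (bopM x z) = bopM u (bopM (bopM x z) (adj u))].

Definition properly_outer (N : set bop) (a : bop -> bop) : Prop :=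
  ~ exists z, [/\ vn_center N z, is_projection z, z <> 0 &
                  inner_on_corner N a z].

End bounded_operators.

Section crossed_product.
Variables (R : realType) (H : hilbertType R) (G : groupType).
Variable alpha : G -> bop H -> bop H.
Local Open Scope group_scope.

Definition group_action (N : set (bop H)) : Prop :=
  (forall g, automorphism N (alpha g)) /\
  (forall g h x, N x -> alpha (g * h) x = alpha g (alpha h x)).

(* T is the operator pi(x), resp. lambda(g), on l2(G, H); with these conventions
   lambda(g) pi(x) lambda(g)^* = pi(alpha_g(x)). *)
Definition is_pi (x : bop H) (T : bop (l2 G H)) : Prop :=
  forall (xi : l2 G H) h, T xi h = alpha h^-1 x (xi h).

Definition is_lambda (g : G) (T : bop (l2 G H)) : Prop :=
  forall (xi : l2 G H) h, T xi h = xi (g^-1 * h).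

(* The copy pi(A) of a subset A of N; pi(x) is a bounded operator for every x in
   N because *-automorphisms are isometric. *)
Definition canonical_copy (A : set (bop H)) : set (bop (l2 G H)) :=
  [set T | exists2 x, A x & is_pi x T].

Definition crossed_product (N : set (bop H)) : set (bop (l2 G H)) :=
  commutant (commutant
    (canonical_copy N `|` [set T | exists g, is_lambda g T])).

End crossed_product.

(* Main.v *)
Require Import Defs.
From mathcomp Require Import all_boot all_order all_algebra.
From mathcomp Require Import finmap complex.
From mathcomp Require Import all_classical all_reals topology normedtype.
From mathcomp Require Import analysis.showcase.summability.
From mathcomp Require Import ring.

Set Implicit Arguments.
Unset Strict Implicit.
Unset Printing Implicit Defensive.

Import Order.TTheory GRing.Theory Num.Theory.
Import numFieldNormedType.Exports.

Local Open Scope classical_set_scope.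
Local Open Scope ring_scope.

(** The crossed product consists of operator matrices of the form
    [\sum_g pi (x_g) lambda_g] with coefficients [x_g] in [N]: the entry at
    [(g, h)] is the image under [alpha g^-1] of the entry at [(1, h g^-1)]
    ([crossed_product_matrix]). Everything else is read off this description.

    Suppose first that the action on the center [Z] is properly outer. If [T] in
    the crossed product commutes with the copy of [Z], each coefficient [x] of
    [T] off the diagonal satisfies [z x = x alpha_g (z)] on [Z] for some
    [g <> 1]. As [x] commutes with [Z], [z] and [alpha_g (z)] agree on the
    central support [p] of [x]. It follows that [alpha_g] fixes [p] and is the
    identity on the corner [Z p], so that [p = 0] ([center_properly_outer]).
    Thus [T] is diagonal, and the relative commutant of [Z] is [N]. The unitaries
    [pi u lambda_g], with [u] unitary in [N], normalize [Z], and their span is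
    weak-* dense because [N] is spanned by its unitaries
    ([vn_unitary_span], [bicommutant_weakstar]). The expectation takes [T] to
    the diagonal operator with the coefficient [x_1].

    Conversely, if [alpha_g] is the identity on [Z p] for some [g <> 1] and some
    nonzero central projection [p], then [pi p lambda_g] commutes with the copy
    of [Z] without being diagonal, which contradicts that [N] is the relative
    commutant of [Z].

    The delicate point is that the description by coefficients survives strong
    limits, although automorphisms are only assumed to be algebraic. What has
    to be shown is that the graph of an automorphism [a] of [N] is closed for
    the strong operator topology ([aut_graph_closed]). Let [(n, a n)] tend to
    [(0, y)] and let [eta] be a vector. The functional [<a T eta, eta>] need not
    be dominated by a vector functional, but it is so below some nonzero
    element under any nonzero positive element ([dominated_below]). There,
    convergence of [n] controls [a n], and [y (a b eta) = 0] for a nonzero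
    positive [b]. Since [a] preserves suprema, a maximality argument brings [b]
    up to 1 and [y eta = 0] follows. This uses square roots of positive elements
    of [N], but no spectral projections. The same closedness shows that the
    copies of [N] and [Z] are von Neumann algebras ([copy_vn]). *)

(** * Hilbert spaces: orthogonal projections and the Riesz theorem *)

Section hilbert.
Variables (R : realType) (H : hilbertType R).
Implicit Types x y z k : H.

Lemma innerNl x z : inner (- x) z = - inner x z.
Proof. by rewrite -scaleN1r innerZl mulN1r. Qed.

Lemma innerBl x y z : inner (x - y) z = inner x z - inner y z.
Proof. by rewrite innerDl innerNl. Qed.

Lemma innerNr x z : inner z (- x) = - inner z x.
Proof. by rewrite innerC innerNl rmorphN /= -innerC. Qed.

Lemma innerBr x y z : inner z (x - y) = inner z x - inner z y.
Proof. by rewrite innerDr innerNr. Qed.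

Lemma inner0r z : inner z (0 : H) = 0.
Proof. by rewrite innerC inner0l rmorph0. Qed.

Lemma innerxx_eq0 x : inner x x = 0 -> x = 0.
Proof.
by rewrite innerxx => /eqP; rewrite expf_eq0 /= normr_eq0 => /eqP.
Qed.

Lemma inner_ext x y : (forall z, inner x z = inner y z) -> x = y.
Proof.
move=> xy; apply/subr0_eq/innerxx_eq0.
by rewrite innerBl xy subrr.
Qed.

Lemma normD_sqr x y :
  `|x + y| ^+ 2 = `|x| ^+ 2 + (inner x y + inner y x) + `|y| ^+ 2.
Proof. by rewrite -!innerxx innerDl !innerDr; ring. Qed.

Lemma parallelogram x y :
  `|x + y| ^+ 2 + `|x - y| ^+ 2 = 2 * `|x| ^+ 2 + 2 * `|y| ^+ 2.
Proof. by rewrite !normD_sqr normrN innerNl innerNr; ring. Qed.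

Lemma CauchySchwarz x y : `|inner x y| <= `|x| * `|y|.
Proof.
have [->|y0] := eqVneq y 0; first by rewrite inner0r !normr0 mulr0.
have yy0 : 0 < inner y y by rewrite innerxx exprn_gt0// normr_gt0.
rewrite -(@ler_pXn2r _ 2) ?nnegrE ?mulr_ge0// exprMn -!innerxx normCK.
set c := - (inner x y / inner y y).
have : 0 <= inner (c *: y + x) (c *: y + x) by rewrite innerxx exprn_ge0.
rewrite innerDl !innerDr !innerZl !innerZr.
have ww : (inner y y)^* = inner y y by rewrite -innerC.
rewrite /c rmorphN rmorphM fmorphV /= ww [inner y x]innerC.
set p := inner x y; set q := p^*; set u := inner x x.
set w := inner y y in yy0 *.
have wn0 : w != 0 by rewrite gt_eqF.
rewrite [X in 0 <= X -> _](_ : _ = (u * w - p * q) / w); last by field.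
by rewrite pmulr_lge0 ?invr_gt0// subr_ge0.
Qed.

Lemma eps_eq0 (a c : R[i]) : 0 <= c ->
  (forall e, 0 < e -> `|a| <= c * e) -> a = 0.
Proof.
move=> c0 ac; apply/eqP/negPn/negP; rewrite -normr_gt0 => a0.
have c1 : 0 < c + 1 by rewrite ltr_wpDl.
have /ac : 0 < `|a| / (c + 1) by rewrite divr_gt0.
by rewrite mulrCA ler_pMr// ler_pdivlMr// mul1r gerDl ler10.
Qed.

Lemma eps_vec_eq0 x (c : R[i]) : 0 <= c ->
  (forall e, 0 < e -> `|x| <= c * e) -> x = 0.
Proof.
move=> c0 xc; apply/normr0_eq0/(eps_eq0 c0) => e e0.
by rewrite normr_id xc.
Qed.

Lemma ge0_eps (a c : R[i]) : 0 <= c ->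
  (forall e, 0 < e -> exists2 b, 0 <= b & `|a - b| <= c * e) -> 0 <= a.
Proof.
move=> c0 ac; suff <- : `|a| = a by [].
apply/subr0_eq/(@eps_eq0 _ (c + c)) => [|e /ac[b b0 ab]].
  by rewrite addr_ge0.
have -> : `|a| - a = (`|a| - `|b|) - (a - b).
  by rewrite (ger0_norm b0) opprB addrA subrK.
rewrite (le_trans (ler_normB _ _))// mulrDl lerD//.
exact: le_trans (ler_dist_dist _ _) ab.
Qed.

(** Completeness, packaged for the two uses made of it: minimizing sequences
    and monotone nets of operators. *)
Lemma hilbert_complete (T : Type) (F : set_system T) (f : T -> H) :
  ProperFilter F ->
  (forall e : R[i], 0 < e -> exists k, F [set t | `|k - f t| < e]) ->
  exists p, forall e : R[i], 0 < e -> F [set t | `|p - f t| < e].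
Proof.
move=> FF Fc; have : cvg (f @ F).
  apply: cauchy_cvg; apply: cauchy_exP => e e0.
  by have [k Fk] := Fc e e0; exists k; rewrite -ball_normE.
move=> /cvg_ex[p /cvgrPdist_lt pF]; exists p => e e0; exact: pF.
Qed.

Lemma ge0_has_inf (A : set R[i]) : A !=set0 -> (forall a, A a -> 0 <= a) ->
  exists d : R[i], (forall a, A a -> d <= a) /\
    forall e, 0 < e -> exists2 a, A a & a < d + e.
Proof.
move=> [a0 Aa0] A0.
have AE a : A a -> a = (complex.Re a)%:C%C.
  by move=> /A0 a0'; rewrite RRe_real // ger0_real.
pose B := [set complex.Re a | a in A].
have iB : has_inf B.
  split; first by exists (complex.Re a0); exists a0.
  by exists 0 => _ [a Aa <-]; rewrite -ler0c -AE// A0.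
exists (inf B)%:C%C; split=> [a Aa|e e0].
  by rewrite (AE a Aa) lecR; apply: ge_inf; [exact: iB.2|exists a].
have eE : e = (complex.Re e)%:C%C by rewrite RRe_real // gtr0_real.
have e1 : 0 < complex.Re e by rewrite -ltcR -eE.
have [_ [a Aa <-] ae] := inf_adherent e1 iB.
by exists a => //; rewrite (AE a Aa) eE -rmorphD /= ltcR.
Qed.

(** A point of the closure of the subspace [K], phrased without the closure:
    minimizing sequences for the distance to [K] are Cauchy by the
    parallelogram identity. *)
Lemma projection_theorem (K : set H) x : K 0 ->
  (forall (a : R[i]) k k', K k -> K k' -> K (a *: k + k')) ->
  exists p, (forall e : R[i], 0 < e -> exists2 k, K k & `|p - k| < e) /\
    forall k, K k -> inner (x - p) k = 0.
Proof.
move=> K0 Kl.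
have [||d [dK dA]] := @ge0_has_inf [set `|x - k| ^+ 2 | k in K].
- by exists (`|x - 0| ^+ 2), 0.
- by move=> _ [k _ <-]; rewrite exprn_ge0.
have {}dK k : K k -> d <= `|x - k| ^+ 2 by move=> Kk; apply: dK; exists k.
have {}dA e : 0 < e -> exists2 k, K k & `|x - k| ^+ 2 < d + e.
  by move=> /dA[_ [k Kk <-]]; exists k.
pose F := [set A : set H | exists2 e : R[i], 0 < e &
  forall k, K k -> `|x - k| ^+ 2 < d + e -> A k].
have FF : ProperFilter F.
  split=> [[e e0]|]; first by have [k Kk kd] := dA e e0 => /(_ k Kk kd).
  split=> [|A B [e e0 eA] [e' e0' eB]|A B AB [e e0 eA]].
  - by exists 1.
  - have ee : e >=< e' by rewrite real_comparable ?gtr0_real.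
    exists (Order.min e e'); first by rewrite comparable_lt_min ?e0//.
    move=> k Kk; rewrite -ltrBlDl comparable_lt_min// => /andP[h h'].
    by split; [apply: eA|apply: eB] => //; rewrite -ltrBlDl.
  - by exists e => // k Kk kd; exact/AB/eA.
have close k k' e : K k -> K k' -> `|x - k| ^+ 2 < d + e ->
    `|x - k'| ^+ 2 < d + e -> `|k - k'| ^+ 2 <= 4 * e.
  move=> Kk Kk' kd kd'.
  have := parallelogram (x - k) (x - k').
  have -> : x - k - (x - k') = - (k - k')
    by rewrite [x - k]addrC addrKA opprK opprB addrC.
  rewrite normrN.
  have -> : x - k + (x - k') = 2 *: (x - 2^-1 *: (k + k')).
    rewrite scalerBr scalerA mulfV ?pnatr_eq0// scale1r opprD addrACA.
    by rewrite scaler_nat mulr2n.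
  have h : d <= `|x - 2^-1 *: (k + k')| ^+ 2.
    apply: dK; rewrite scalerDr; apply: (Kl) => //.
    by rewrite -[_ *: k']addr0; apply: Kl.
  rewrite normrZ normr_nat exprMn => /(canRL (addKr _)) ->.
  rewrite [leRHS](_ : _ = - (2 ^+ 2 * d) + (2 * (d + e) + 2 * (d + e))).
    by apply: lerD; [rewrite lerN2 ler_pM2l// exprn_gt0|
       apply: lerD; rewrite ler_pM2l// ltW].
  by ring.
have [e e0|p pF] := @hilbert_complete _ F id FF.
  have e20 : 0 < e ^+ 2 / 8 by rewrite divr_gt0// exprn_gt0.
  have [k Kk kd] := dA _ e20; exists k, (e ^+ 2 / 8) => // k' Kk' kd'.
  rewrite /= -(@ltr_pXn2r _ 2) ?nnegrE ?(ltW e0)//.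
  apply: le_lt_trans (close _ _ _ Kk Kk' kd kd') _.
  rewrite mulrCA gtr_pMr ?exprn_gt0//.
  by rewrite -subr_gt0 (_ : 1 - _ = 2^-1) ?invr_gt0//; field.
have FK : F K by exists 1.
exists p; split=> [e e0|k Kk].
  by have [k [Kk kp]] := filter_ex (filterI FK (pF e e0)); exists k.
apply: (@eps_eq0 _ (2 * `|k|)) => [|e e0]; first by rewrite mulr_ge0.
have [e2 Fe] : 0 < e ^+ 2 /\ F [set k | `|x - k| ^+ 2 < d + e ^+ 2].
  by rewrite exprn_gt0//; split=> //; exists (e ^+ 2); rewrite ?exprn_gt0.
have [k1 [Kk1 [kp kd]]] := filter_ex (filterI FK (filterI (pF e e0) Fe)).
have -> : x - p = (x - k1) - (p - k1) by rewrite opprB addrA subrK.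
rewrite innerBl (le_trans (ler_normB _ _))//.
have -> : 2 * `|k| * e = e * `|k| + e * `|k| by ring.
apply: lerD; last first.
  by apply: le_trans (CauchySchwarz _ _) _; rewrite ler_wpM2r// ltW.
have [->|k0] := eqVneq k 0; first by rewrite inner0r !normr0 mulr0.
rewrite -(@ler_pXn2r _ 2) ?nnegrE ?mulr_ge0 ?(ltW e0)// exprMn -innerxx normCK.
have w0 : 0 < inner k k by rewrite innerxx exprn_gt0// normr_gt0.
pose a := inner (x - k1) k / inner k k.
(* [k1] is within [e ^+ 2] of the minimum, which bounds how much adding the
   best multiple [a] of [k] can improve it *)
have : d <= `|x - (a *: k + k1)| ^+ 2 by apply/dK/Kl.
have -> : x - (a *: k + k1) = (x - k1) - a *: k by rewrite opprD addrCA addrC.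
move: kd => /=; rewrite -!innerxx /a; move: (x - k1) => v.
rewrite innerBl !innerBr !innerZl !innerZr [inner k v]innerC.
set t := inner v k; set w := inner k k in w0 *.
set u := inner v v; set t' := t^*.
have ww : w^* = w by rewrite /w -innerC.
have wn0 : w != 0 by rewrite gt_eqF.
rewrite rmorphM fmorphV /= ww -/t' => kd dk.
rewrite -ler_pdivrMr//.
rewrite [leLHS](_ : _ =
    u - (u - t' / w * t - (t / w * t' - t / w * (t' / w * w)))); last by field.
by rewrite lerBlDr (le_trans (ltW kd))// addrC lerD2l.
Qed.

Lemma bop_of (f : H -> H) (c : R[i]) : linear f -> 0 <= c ->
  (forall x, `|f x| <= c * `|x|) -> exists T : bop H, forall x, T x = f x.
Proof.
move=> fl c0 fc.
suff fP : f \in @bounded_linear R H by exists (Bop fP).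
apply/asboolP; split=> // x; apply/cvgrPdist_lt => e e0.
have c1 : 0 < c + 1 by rewrite ltr_wpDl.
have d0 : 0 < e / (c + 1) by rewrite divr_gt0.
have : nbhs x (ball x (e / (c + 1))) by exact: nbhsx_ballx.
apply: filterS => y; rewrite -ball_normE /= => xy.
have -> : f x - f y = f (x - y).
  by rewrite addrC -scaleN1r -fl scaleN1r addrC.
apply: le_lt_trans (fc _) _.
apply: le_lt_trans (_ : _ <= (c + 1) * `|x - y|) _.
  by rewrite ler_wpM2r// lerDl.
by rewrite mulrC -ltr_pdivlMr.
Qed.

Lemma bop_linear (T : bop H) : linear T.
Proof. by have /asboolP[] := bopP T. Qed.

Lemma bopD (T : bop H) x y : T (x + y) = T x + T y.
Proof. by have := bop_linear T 1 x y; rewrite !scale1r. Qed.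

Lemma bop0 (T : bop H) : T 0 = 0.
Proof. by apply: (addrI (T 0)); rewrite -bopD !addr0. Qed.

Lemma bopZ (T : bop H) a x : T (a *: x) = a *: T x.
Proof. by rewrite -[a *: x]addr0 bop_linear bop0 addr0. Qed.

Lemma bopN (T : bop H) x : T (- x) = - T x.
Proof. by rewrite -scaleN1r bopZ scaleN1r. Qed.

Lemma bopB (T : bop H) x y : T (x - y) = T x - T y.
Proof. by rewrite bopD bopN. Qed.

Lemma bop_sum (T : bop H) (I : Type) (s : seq I) (f : I -> H) :
  T (\sum_(i <- s) f i) = \sum_(i <- s) T (f i).
Proof.
by elim: s => [|i s IH]; rewrite ?big_nil ?bop0// !big_cons bopD IH.
Qed.

Lemma bop_bounded (T : bop H) :
  exists2 c : R[i], 0 < c & forall x, `|T x| <= c * `|x|.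
Proof.
have /asboolP[_ /(_ 0) /cvgrPdist_lt/(_ 1 ltr01)] := bopP T.
rewrite bop0 => /nbhs_ballP[d /= d0 dT].
exists (2 / d) => [|x]; first by rewrite divr_gt0.
have [->|x0] := eqVneq x 0; first by rewrite bop0 !normr0 mulr0.
have nx : 0 < `|x| by rewrite normr_gt0.
pose a := d / (2 * `|x|).
have a0 : 0 < a by rewrite divr_gt0// mulr_gt0.
have : `|0 - T (a *: x)| < 1.
  apply: dT; rewrite -ball_normE /= sub0r normrN normrZ (gtr0_norm a0).
  rewrite (_ : a * `|x| = d / 2); last by rewrite /a; field; rewrite gt_eqF.
  by rewrite gtr_pMr// invf_lt1// ltr1n.
rewrite sub0r normrN bopZ normrZ (gtr0_norm a0) => /ltW.
rewrite -ler_pdivlMl// mulr1 => /le_trans; apply.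
by rewrite le_eqVlt /a; apply/orP; left; apply/eqP; field; rewrite !gt_eqF.
Qed.

(** [P] is the orthogonal projection onto the closure of the subspace [K]; this
    form spares the theory of closed subspaces. *)
Definition projects_on_closure (K : set H) (P : bop H) :=
  [/\ forall x y, inner (P x) y = inner x (P y),
    forall x (e : R[i]), 0 < e -> exists2 k, K k & `|P x - k| < e &
    forall k, K k -> P k = k].

Lemma orthogonal_projection (K : set H) : K 0 ->
  (forall (a : R[i]) k k', K k -> K k' -> K (a *: k + k')) ->
  exists P, projects_on_closure K P.
Proof.
move=> K0 Kl.
have /choice[f fP] x := projection_theorem x K0 Kl.
have fK x e : 0 < e -> exists2 k, K k & `|f x - k| < e.
  by have [+ _] := fP x; apply.
have fo x k : K k -> inner (x - f x) k = 0 by have [_] := fP x; apply.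
(* [f x] lies in the closure of [K], so it is orthogonal to [K^perp] *)
have ort z x : (forall k, K k -> inner z k = 0) -> inner z (f x) = 0.
  move=> zK; apply: (@eps_eq0 _ `|z|) => // e e0.
  have [k Kk xk] := fK x e e0.
  rewrite -[f x](subrK k) innerDr (zK k)// addr0.
  by apply: le_trans (CauchySchwarz _ _) _; rewrite ler_wpM2l// ltW.
have fo2 x y : inner (x - f x) (f y) = 0 by apply: ort => k; exact: fo.
have sym x y : inner (f x) y = inner x (f y).
  have := fo2 x y; rewrite innerBl => /subr0_eq ->.
  have /eqP := fo2 y x; rewrite innerBl subr_eq0 => /eqP.
  by rewrite innerC [RHS]innerC => /(can_inj (@conjCK _)).
have fl : linear f.
  move=> a x y; apply: inner_ext => z.
  by rewrite innerDl innerZl !sym innerDl innerZl.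
have fb x : `|f x| <= 1 * `|x|.
  rewrite mul1r -(@ler_pXn2r _ 2) ?nnegrE// -!innerxx.
  have /eqP := fo2 x x; rewrite innerBl subr_eq0 => /eqP <-.
  rewrite -subr_ge0 -innerBr.
  have -> : inner x (x - f x) = inner (x - f x) (x - f x).
    by rewrite [RHS]innerBl [inner (f x) _]innerC fo2 rmorph0 subr0.
  by rewrite innerxx exprn_ge0.
have [P PE] := bop_of fl ler01 fb.
exists P; split=> [x y|x|k Kk]; rewrite ?PE//; first exact: fK.
by apply/esym/subr0_eq/innerxx_eq0; rewrite innerBr fo// fo2 subrr.
Qed.

(** The Riesz representation theorem: a functional is the inner product with
    a vector orthogonal to its kernel. *)
Lemma riesz (f : H -> R[i]) (c : R[i]) : 0 <= c ->
  (forall a x y, f (a *: x + y) = a * f x + f y) ->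
  (forall x, `|f x| <= c * `|x|) -> exists y, forall x, f x = inner x y.
Proof.
move=> c0 fl fc.
have f0 : f 0 = 0.
  by have := fl (-1) 0 0; rewrite scaler0 addr0 mulN1r addNr.
have fB x y : f (x - y) = f x - f y.
  by rewrite addrC -scaleN1r fl mulN1r addrC.
have [f0'|/existsNP[x0 /eqP fx0]] := pselect (forall x, f x = 0).
  by exists 0 => x; rewrite f0' inner0r.
have [//|a k k' /= fk fk'|p [pK po]] :=
    @projection_theorem [set x | f x = 0] x0.
  by rewrite fl fk fk' mulr0 addr0.
have z0 : x0 - p != 0.
  apply: contra_neq fx0 => /subr0_eq ->.
  apply: (@eps_eq0 _ c) => // e e0; have [k fk pk] := pK e e0.
  rewrite -[f p]subr0 -[X in _ - X]fk -fB (le_trans (fc _))//.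
  by rewrite ler_wpM2l// ltW.
set z := x0 - p in po z0.
have zz : inner z z != 0 by rewrite innerxx expf_neq0// normr_eq0.
exists ((f z / inner z z)^* *: z) => x.
have : inner z (f x *: z - f z *: x) = 0.
  by apply: po; rewrite /= fB -[f x *: z]addr0 -[f z *: x]addr0 !fl f0; ring.
rewrite innerC innerBl !innerZl => /eqP; rewrite conjC_eq0 subr_eq0 => /eqP h.
by rewrite innerZr conjCK mulrAC -h mulfK.
Qed.

Lemma adj_exists (T : bop H) :
  exists S : bop H, forall x y, inner (T x) y = inner x (S y).
Proof.
have [c c0 Tc] := bop_bounded T.
have /choice[f fP] : forall y, exists z, forall x, inner (T x) y = inner x z.
  move=> y; apply: (@riesz (fun x => inner (T x) y) (c * `|y|)).
  - by rewrite mulr_ge0// ltW.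
  - by move=> a x z; rewrite bop_linear innerDl innerZl.
  - move=> x; apply: le_trans (CauchySchwarz _ _) _.
    by rewrite mulrAC ler_wpM2r.
have [|||S SE] := @bop_of f c.
- move=> a x y; apply: inner_ext => z.
  have fC w : inner (f w) z = inner w (T z) by rewrite innerC -fP -innerC.
  by rewrite fC innerDl innerZl [RHS]innerDl innerZl !fC.
- exact: ltW.
- move=> y; have [->|fy0] := eqVneq (f y) 0.
    by rewrite normr0 mulr_ge0// ltW.
  have n0 : 0 < `|f y| by rewrite normr_gt0.
  rewrite -(ler_pM2l n0) -expr2 -innerxx -fP.
  have h : inner (T (f y)) y = `|inner (T (f y)) y|.
    by rewrite fP innerxx ger0_norm// exprn_ge0.
  rewrite h; apply: le_trans (CauchySchwarz _ _) _.
  by rewrite mulrCA mulrA ler_wpM2r.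
by exists S => x y; rewrite SE.
Qed.

Lemma adjP (T : bop H) x y : inner (T x) y = inner x (adj T y).
Proof.
rewrite /adj; have [S SP] := adj_exists T.
by case: xgetP => [_ _ /(_ x y)//|/(_ S)]; case.
Qed.

Lemma adjPr (T : bop H) x y : inner x (T y) = inner (adj T x) y.
Proof. by rewrite innerC adjP -innerC. Qed.

End hilbert.
(** * Operators: adjoints, order, commutants and monotone limits *)

Section operators.
Variables (R : realType) (H : hilbertType R).
Implicit Types (x y : H) (S T U B D W : bop H) (A C N : set (bop H)).

Lemma bop_ext S T : (forall x, S x = T x) -> S = T.
Proof. by move=> ST; apply/val_inj/funext. Qed.

Lemma bopDE S T x : (S + T) x = S x + T x. Proof. by []. Qed.
Lemma bopBE S T x : (S - T) x = S x - T x. Proof. by []. Qed.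
Lemma bopNE T x : (- T) x = - T x. Proof. by []. Qed.
Lemma bopZE a T x : (a *: T) x = a *: T x. Proof. by []. Qed.
Lemma bop0E x : (0 : bop H) x = 0. Proof. by []. Qed.
Lemma bopME S T x : bopM S T x = S (T x). Proof. by []. Qed.
Lemma bop1E x : bop1 H x = x. Proof. by []. Qed.

Definition bopE := (bopDE, bopBE, bopNE, bopZE, bop0E, bopME, bop1E).

Lemma bop_sumE (I : Type) (s : seq I) (f : I -> bop H) x :
  (\sum_(i <- s) f i) x = \sum_(i <- s) f i x.
Proof. by elim: s => [|i s IH]; rewrite ?big_nil// !big_cons bopDE IH. Qed.

Lemma bopMA S T U : bopM S (bopM T U) = bopM (bopM S T) U.
Proof. exact: bop_ext. Qed.

Lemma bopM1 T : bopM T (bop1 H) = T. Proof. exact: bop_ext. Qed.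
Lemma bop1M T : bopM (bop1 H) T = T. Proof. exact: bop_ext. Qed.
Lemma bop0M T : bopM 0 T = 0. Proof. exact: bop_ext. Qed.
Lemma bopM0 T : bopM T 0 = 0.
Proof. by apply: bop_ext => x; rewrite !bopE bop0. Qed.

Lemma bopMDl S T U : bopM (S + T) U = bopM S U + bopM T U.
Proof. exact: bop_ext. Qed.
Lemma bopMDr S T U : bopM U (S + T) = bopM U S + bopM U T.
Proof. by apply: bop_ext => x; rewrite !bopE bopD. Qed.
Lemma bopMZl a S T : bopM (a *: S) T = a *: bopM S T.
Proof. exact: bop_ext. Qed.
Lemma bopMZr a S T : bopM S (a *: T) = a *: bopM S T.
Proof. by apply: bop_ext => x; rewrite !bopE bopZ. Qed.
Lemma bopMBl S T U : bopM (S - T) U = bopM S U - bopM T U.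
Proof. exact: bop_ext. Qed.
Lemma bopMBr S T U : bopM U (S - T) = bopM U S - bopM U T.
Proof. by apply: bop_ext => x; rewrite !bopE bopB. Qed.

Lemma adj_unique S T : (forall x y, inner (T x) y = inner x (S y)) ->
  adj T = S.
Proof.
move=> TS; apply: bop_ext => y; apply: inner_ext => x.
by rewrite -adjPr innerC TS -innerC.
Qed.

Lemma adjK T : adj (adj T) = T.
Proof. by apply: adj_unique => x y; rewrite adjPr. Qed.

Lemma adjM S T : adj (bopM S T) = bopM (adj T) (adj S).
Proof. by apply: adj_unique => x y; rewrite !bopE !adjP. Qed.

Lemma adjD S T : adj (S + T) = adj S + adj T.
Proof.
by apply: adj_unique => x y; rewrite !bopE innerDl innerDr !adjP.
Qed.

Lemma adjZ a T : adj (a *: T) = a^* *: adj T.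
Proof.
by apply: adj_unique => x y; rewrite !bopE innerZl innerZr conjCK adjP.
Qed.

Lemma adjN T : adj (- T) = - adj T.
Proof. by rewrite -scaleN1r adjZ rmorphN1 scaleN1r. Qed.

Lemma adjB S T : adj (S - T) = adj S - adj T.
Proof. by rewrite adjD adjN. Qed.

Lemma adj1 : adj (bop1 H) = bop1 H. Proof. exact: adj_unique. Qed.

(** Polarization: this needs complex scalars. *)
Lemma quadratic_form_eq0 D : (forall x, inner (D x) x = 0) -> D = 0.
Proof.
move=> D0; apply: bop_ext => x; apply/innerxx_eq0 => /=.
have h a : a^* * inner (D x) (D x) + a * inner (D (D x)) x = 0.
  have := D0 (x + a *: D x); rewrite bopD bopZ innerDl !innerDr !innerZl.
  by rewrite !innerZr !D0 add0r !mulr0 addr0.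
have h1 := h 1; have h2 := h 'i.
rewrite rmorph1 !mul1r in h1; rewrite conjCi mulNr in h2.
have {}h1 := addr0_eq h1; rewrite -h1 mulrN -opprD -mulr2n in h2.
move: h2 => /eqP; rewrite oppr_eq0 mulrn_eq0 /= mulf_eq0 (negPf (neq0Ci _)) /=.
by move=> /eqP.
Qed.

Lemma bop_leE S T :
  bop_le S T <-> forall x, inner (S x) x <= inner (T x) x.
Proof.
by split=> + x => /(_ x); rewrite bopBE innerBl subr_ge0.
Qed.

Lemma bop_ge0E T : bop_le 0 T <-> forall x, 0 <= inner (T x) x.
Proof.
by rewrite bop_leE; split=> + x => /(_ x); rewrite bop0E inner0l.
Qed.

Lemma bop_le_refl T : bop_le T T. Proof. by apply/bop_leE. Qed.

Lemma bop_le_trans T S U : bop_le S T -> bop_le T U -> bop_le S U.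
Proof.
move=> /bop_leE ST /bop_leE TU; apply/bop_leE => x.
exact: le_trans (ST x) (TU x).
Qed.

Lemma bop_le_anti S T : bop_le S T -> bop_le T S -> S = T.
Proof.
move=> /bop_leE ST /bop_leE TS; apply/subr0_eq/quadratic_form_eq0 => x.
by apply/eqP; rewrite bopBE innerBl subr_eq0 eq_le ST TS.
Qed.

Lemma bop_leB0 S T : bop_le S T <-> bop_le 0 (T - S).
Proof.
rewrite bop_leE bop_ge0E.
by split=> + x => /(_ x); rewrite bopBE innerBl subr_ge0.
Qed.

Lemma adj_ge0 T : bop_le 0 T -> adj T = T.
Proof.
move=> /bop_ge0E T0; apply/subr0_eq/quadratic_form_eq0 => x.
by rewrite bopBE innerBl -adjPr innerC geC0_conj// subrr.
Qed.

Lemma adjM_ge0 T : bop_le 0 (bopM (adj T) T).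
Proof. by apply/bop_ge0E => x; rewrite bopME -adjPr innerxx exprn_ge0. Qed.

(** Positivity of the form of [D] at the vector [x - c^-1 D x]. *)
Lemma ge0_norm_sqr_le D c : bop_le 0 D -> 0 < c ->
  (forall x, inner (D x) x <= c * `|x| ^+ 2) ->
  forall x, `|D x| ^+ 2 <= c * inner (D x) x.
Proof.
move=> D0 c0 Dc x; have DD := adj_ge0 D0; move/bop_ge0E : D0 => D0.
have := D0 (x - c^-1 *: D x).
have cc : c^* = c by rewrite geC0_conj// ltW.
rewrite bopB bopZ innerBl !innerBr !innerZl !innerZr fmorphV /= cc.
have -> : inner (D (D x)) x = inner (D x) (D x) by rewrite adjP DD.
rewrite -innerxx.
set u := inner _ x; set v := inner (D x) (D x).
set w := inner (D (D x)) (D x) => h.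
have wv : w <= c * v by rewrite /v innerxx; exact: Dc.
rewrite mulrC -ler_pdivrMr// -subr_ge0.
apply: (le_trans h); rewrite -subr_ge0.
rewrite [leRHS](_ : _ = c^-1 * c^-1 * (c * v - w)).
  by rewrite mulr_ge0 ?subr_ge0// mulr_ge0// invr_ge0 ltW.
by field; rewrite gt_eqF.
Qed.

(** ** Commutants *)

Lemma commutantS A C : A `<=` C -> commutant C `<=` commutant A.
Proof. by move=> AC T CT S /AC; exact: CT. Qed.

Lemma sub_bicommutant A : A `<=` commutant (commutant A).
Proof. by move=> T AT S /(_ T AT). Qed.

Lemma commutant3 A : commutant (commutant (commutant A)) = commutant A.
Proof.
apply/seteqP; split; last exact: sub_bicommutant.
exact/commutantS/sub_bicommutant.
Qed.

Lemma commutant_lin A a S T :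
  commutant A S -> commutant A T -> commutant A (a *: S + T).
Proof.
move=> AS AT U AU.
by rewrite bopMDl bopMDr bopMZl bopMZr (AS U)// (AT U).
Qed.

Lemma commutantM A S T : commutant A S -> commutant A T ->
  commutant A (bopM S T).
Proof. by move=> AS AT U AU; rewrite bopMA AS// -bopMA AT// bopMA. Qed.

Lemma commutant1 A : commutant A (bop1 H).
Proof. by move=> U _; rewrite bopM1 bop1M. Qed.

Lemma commutant0 A : commutant A 0.
Proof. by move=> U _; rewrite bopM0 bop0M. Qed.

Lemma commutantZ A a T : commutant A T -> commutant A (a *: T).
Proof.
move=> AT; rewrite -[a *: T]addr0.
by apply: commutant_lin => //; exact: commutant0.
Qed.

Lemma commutant_adj A : (forall T, A T -> A (adj T)) ->
  forall T, commutant A T -> commutant A (adj T).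
Proof.
move=> AA T AT S AS; apply: (can_inj adjK); rewrite !adjM !adjK.
by rewrite (AT _ (AA _ AS)).
Qed.

Lemma bicommutant_vn A : (forall T, A T -> A (adj T)) ->
  von_neumann (commutant (commutant A)).
Proof.
move=> AA; split; last exact: commutant3.
exact/commutant_adj/commutant_adj.
Qed.

Section von_neumann_algebra.
Variable N : set (bop H).
Hypothesis vN : von_neumann N.

Lemma vn_adj T : N T -> N (adj T). Proof. exact: vN.1. Qed.

Lemma vn_bicomm T : commutant (commutant N) T -> N T.
Proof. by rewrite vN.2. Qed.

Lemma vn_lin a S T : N S -> N T -> N (a *: S + T).
Proof. by rewrite -vN.2; exact: commutant_lin. Qed.

Lemma vnM S T : N S -> N T -> N (bopM S T).
Proof. by rewrite -vN.2; exact: commutantM. Qed.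

Lemma vn1 : N (bop1 H).
Proof. by rewrite -vN.2; exact: commutant1. Qed.

Lemma vn0 : N 0.
Proof. by have := vn_lin (-1) vn1 vn1; rewrite scaleN1r addNr. Qed.

Lemma vnZ a T : N T -> N (a *: T).
Proof. by rewrite -vN.2; exact: commutantZ. Qed.

Lemma vnD S T : N S -> N T -> N (S + T).
Proof. by move=> NS; rewrite -[S]scale1r; exact: vn_lin. Qed.

Lemma vnB S T : N S -> N T -> N (S - T).
Proof. by move=> NS NT; rewrite addrC -scaleN1r; exact: vn_lin. Qed.

End von_neumann_algebra.

Lemma vn_center_vn N : von_neumann N -> von_neumann (vn_center N).
Proof.
move=> vN; split=> [T [NT N'T]|].
  by split; [exact: vn_adj|apply: commutant_adj => //; exact: vn_adj].
apply/seteqP; split; last exact: sub_bicommutant.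
move=> T ZT; split; first (apply: vn_bicomm => //; move: T ZT;
  by apply/commutantS/commutantS => ? []).
rewrite -(@commutant3 N); move: T ZT.
by apply/commutantS/commutantS => ? [].
Qed.

(** Strong limits stay in the bicommutant. To commute with [U] at [x] involves
    only the two vectors [x] and [U x]. *)
Lemma bicommutant_sot_closed A T :
  (forall x y e, 0 < e ->
     exists S, [/\ A S, `|T x - S x| < e & `|T y - S y| < e]) ->
  commutant (commutant A) T.
Proof.
move=> AT U A'U; apply: bop_ext => x; apply/subr0_eq.
have [c c0 Uc] := bop_bounded U.
apply: (@eps_vec_eq0 _ _ _ (c + 1)) => [|e e0].
  by rewrite addr_ge0// ltW.
have [S [AS Sx SUx]] := AT x (U x) e e0.
have -> : bopM U T x - bopM T U x = U (T x - S x) - (T (U x) - S (U x)).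
  have := congr1 (fun V : bop H => V x) (A'U S AS); rewrite !bopE bopB => ->.
  by rewrite opprB addrA subrK.
rewrite (le_trans (ler_normB _ _))// mulrDl mul1r.
apply: lerD; last exact: ltW.
by rewrite (le_trans (Uc _))// ler_wpM2l// ltW.
Qed.

Lemma adj_projection (K : set H) (P : bop H) :
  projects_on_closure K P -> adj P = P.
Proof. by case=> Psym _ _; exact: adj_unique. Qed.

Lemma projection_idem (K : set H) (P : bop H) :
  projects_on_closure K P -> bopM P P = P.
Proof.
move=> [_ PX PK]; apply: bop_ext => y; apply/subr0_eq; rewrite bopME.
have [d d0 Pd] := bop_bounded P.
apply: (@eps_vec_eq0 _ _ _ (d + 1)) => [|e e0].
  by rewrite addr_ge0 ?ltW.
have [k Kk yk] := PX y e e0.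
have -> : P (P y) - P y = P (P y - k) - (P y - k).
  by rewrite bopB (PK k)// opprB addrA subrK.
rewrite (le_trans (ler_normB _ _))// mulrDl mul1r lerD//; last exact: ltW.
by rewrite (le_trans (Pd _))// ler_pM2l// ltW.
Qed.

(** Invariance of the closure of [K] under [S] gives [P S P = S P]; the same
    for [adj S] gives [P S P = P S] after taking adjoints. *)
Lemma projection_comm (K : set H) (P S : bop H) : projects_on_closure K P ->
  (forall k, K k -> K (S k)) -> (forall k, K k -> K (adj S k)) ->
  bopM S P = bopM P S.
Proof.
move=> KP SK S'K; have aP := adj_projection KP; have [_ PX PK] := KP.
have inv (u : bop H) : (forall k, K k -> K (u k)) ->
    bopM P (bopM u P) = bopM u P.
  move=> uK; apply: bop_ext => x; apply/subr0_eq; rewrite !bopE.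
  have [c c0 uc] := bop_bounded u; have [d d0 Pd] := bop_bounded P.
  apply: (@eps_vec_eq0 _ _ _ (d * c + c)) => [|e e0].
    by rewrite addr_ge0 ?mulr_ge0 ?ltW.
  have [k Kk xk] := PX x e e0.
  have -> : P (u (P x)) - u (P x) = P (u (P x - k)) - u (P x - k).
    by rewrite !bopB (PK (u k)) ?opprB ?addrA ?subrK//; exact: uK.
  have uk : `|u (P x - k)| <= c * e.
    by rewrite (le_trans (uc _))// ler_pM2l// ltW.
  rewrite (le_trans (ler_normB _ _))// mulrDl lerD// (le_trans (Pd _))//.
  by rewrite -mulrA ler_pM2l.
rewrite -inv//; apply: (can_inj (@adjK)).
by rewrite !adjM aP -[RHS]inv// bopMA.
Qed.

(** ** Monotone nets *)

Definition increases_to A W := [/\ upward_directed A,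
  forall S, A S -> bop_le S W,
  forall U, (forall S, A S -> bop_le S U) -> bop_le W U &
  forall x (e : R[i]), 0 < e ->
    exists2 S1, A S1 & forall S, A S -> bop_le S1 S -> `|W x - S x| < e].

(** Above a member [S0], all differences of members are dominated by [B - S0];
    so convergence of their quadratic forms forces strong convergence. *)
Lemma monotone_limit A B : upward_directed A ->
  (forall S, A S -> bop_le S B) ->
  exists W, increases_to A W.
Proof.
move=> dirA AB; have [[S0 AS0] Adir] := dirA.
have [c c0 Bc] := bop_bounded (B - S0).
have D0q S S' : A S' -> bop_le S0 S -> bop_le S S' ->
    forall x, inner ((S' - S) x) x <= c * `|x| ^+ 2.
  move=> AS' S0S SS' x; apply: (@le_trans _ _ (inner ((B - S0) x) x)).
    rewrite !bopBE !innerBl; apply: lerB.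
      exact: (bop_leE _ _).1 (AB _ AS') x.
    exact: (bop_leE _ _).1 S0S x.
  have h : 0 <= inner ((B - S0) x) x.
    by have /bop_leB0/bop_ge0E := AB _ AS0; apply.
  rewrite -(ger0_norm h) (le_trans (CauchySchwarz _ _))// expr2 mulrA.
  by rewrite ler_wpM2r.
have D0c S S' : A S' -> bop_le S0 S -> bop_le S S' ->
    forall x, `|(S' - S) x| ^+ 2 <= c * inner ((S' - S) x) x.
  move=> AS' S0S SS'; apply: ge0_norm_sqr_le => // [|x]; last exact: D0q.
  exact: (bop_leB0 _ _).1.
pose F := [set X : set (bop H) | exists2 S1, A S1 &
   forall S, A S -> bop_le S1 S -> X S].
have FF : ProperFilter F.
  split=> [[S1 AS1 /(_ S1 AS1)]|]; first by apply; exact: bop_le_refl.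
  split=> [|X Y [S1 AS1 XS1] [S2 AS2 YS2]|X Y XY [S1 AS1 XS1]].
  - by exists S0.
  - have [S3 [AS3 S13 S23]] := Adir _ _ AS1 AS2; exists S3 => // S AS S3S.
    by split; [apply: XS1|apply: YS2] => //; exact: bop_le_trans S3S.
  - by exists S1 => // S AS S1S; apply/XY/XS1.
have FA : F A by exists S0.
have Fle S1 : A S1 -> F [set S | bop_le S1 S] by exists S1.
have cau x (e : R[i]) : 0 < e -> exists k, F [set S | `|k - S x| < e].
  move=> e0.
  have [||d [dP dA]] := @ge0_has_inf _
    [set inner ((B - S) x) x | S in A `&` [set S | bop_le S0 S]].
  - by exists (inner ((B - S0) x) x), S0 => //; split=> //; exact: bop_le_refl.
  - by move=> _ [S [AS _] <-]; have /bop_leB0/bop_ge0E := AB _ AS; apply.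
  have e20 : 0 < e ^+ 2 / (2 * c) by rewrite divr_gt0 ?exprn_gt0// mulr_gt0.
  have [_ [S1 [AS1 S01] <-] S1d] := dA _ e20.
  exists (S1 x), S1 => // S AS S1S /=.
  rewrite -(@ltr_pXn2r _ 2) ?nnegrE ?(ltW e0)// distrC -bopBE.
  apply: le_lt_trans (D0c _ _ AS S01 S1S x) _.
  have h : d <= inner ((B - S) x) x.
    by apply: dP; exists S => //; split=> //; exact: bop_le_trans S1S.
  have := lt_le_trans S1d (lerD h (lexx _)); rewrite -ltrBlDl.
  have -> : inner ((B - S1) x) x - inner ((B - S) x) x = inner ((S - S1) x) x.
    by rewrite !bopBE !innerBl; ring.
  rewrite -(ltr_pM2l c0) => /ltW/le_lt_trans; apply.
  rewrite (_ : c * _ = e ^+ 2 / 2); last by field; rewrite gt_eqF.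
  by rewrite gtr_pMr ?exprn_gt0// invf_lt1// ltr1n.
have /choice[f fP] x := hilbert_complete FF (cau x).
have near2 x y (e : R[i]) : 0 < e ->
    exists S, [/\ A S, bop_le S0 S, `|f x - S x| < e & `|f y - S y| < e].
  move=> e0; have [S [[AS S0S] [Sx Sy]]] := filter_ex (filterI
    (filterI FA (Fle _ AS0)) (filterI (fP x e e0) (fP y e e0))).
  by exists S.
have fl : linear f.
  move=> a x y; apply/subr0_eq.
  apply: (@eps_vec_eq0 _ _ _ (1 + (`|a| + 1))) => [|e e0].
    by rewrite !addr_ge0.
  have [S [[AS S1] [S2 S3]]] := filter_ex (filterI (filterI FA
    (fP (a *: x + y) e e0)) (filterI (fP x e e0) (fP y e e0))).
  have -> : f (a *: x + y) - (a *: f x + f y) =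
      (f (a *: x + y) - S (a *: x + y)) -
      (a *: (f x - S x) + (f y - S y)).
    rewrite bop_linear scalerBr [a *: f x - _ + _]addrACA -[- _ - _]opprD.
    by rewrite [in RHS]opprB addrA subrK.
  rewrite (le_trans (ler_normB _ _))// !mulrDl !mul1r.
  apply: lerD; first exact: ltW.
  rewrite (le_trans (ler_normD _ _))// normrZ.
  by apply: lerD; [rewrite ler_wpM2l// ltW|exact: ltW].
have fb : exists2 b, 0 <= b & forall x, `|f x| <= b * `|x|.
  have [c' c'0 Sc] := bop_bounded S0; exists (c + c' + 1).
    by rewrite !addr_ge0// ltW.
  move=> x; have [->|x0] := eqVneq x 0.
    have := fl (-1) 0 0; rewrite scaler0 addr0 scaleN1r addNr => ->.
    by rewrite !normr0 mulr0.
  have nx : 0 < `|x| by rewrite normr_gt0.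
  have [S [AS S0S Sx _]] := near2 x x _ nx.
  have -> : f x = (f x - S x) + ((S - S0) x + S0 x).
    by rewrite bopBE !subrK.
  rewrite addrC (le_trans (ler_normD _ _))// [leRHS]mulrDl mul1r.
  apply: lerD; last exact: ltW.
  rewrite (le_trans (ler_normD _ _))// mulrDl; apply: lerD => //.
  rewrite -(@ler_pXn2r _ 2) ?nnegrE ?mulr_ge0// ?(ltW c0)//.
  apply: le_trans (D0c _ _ AS (bop_le_refl _) S0S x) _.
  rewrite exprMn [c ^+ 2]expr2 -mulrA ler_pM2l//.
  exact: D0q AS (bop_le_refl _) S0S x.
have [b b0 {}fb] := fb; have [W WE] := bop_of fl b0 fb.
have lim x (e : R[i]) : 0 < e -> F [set S | `|W x - S x| < e].
  by rewrite WE; exact: fP.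
have lim_ge0 x (T : bop H) (a : R[i]) :
    F [set S | 0 <= a * inner ((S - T) x) x] -> 0 <= a * inner ((W - T) x) x.
  move=> FT; apply: (@ge0_eps _ _ (`|a| * `|x|)) => [|e e0].
    by rewrite mulr_ge0.
  have [S [ST Se]] := filter_ex (filterI FT (lim x e e0)).
  exists (a * inner ((S - T) x) x) => //.
  rewrite -mulrBr -innerBl !bopBE opprB addrA subrK normrM -mulrA.
  rewrite ler_wpM2l// (le_trans (CauchySchwarz _ _))// mulrC.
  by rewrite ler_wpM2l// ltW.
exists W; split=> [//|S AS|U AU|//].
- apply/bop_leB0/bop_ge0E => x; rewrite -[inner _ _]mul1r; apply: lim_ge0.
  apply: filterS (Fle _ AS) => S' /= SS'; rewrite mul1r.
  by have /bop_ge0E := (bop_leB0 _ _).1 SS'; apply.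
- apply/bop_leB0/bop_ge0E => x.
  have -> : inner ((U - W) x) x = -1 * inner ((W - U) x) x.
    by rewrite !bopBE !innerBl; ring.
  apply: lim_ge0; apply: filterS FA => S AS /=.
  have /bop_ge0E/(_ x) := (bop_leB0 _ _).1 (AU S AS).
  by rewrite !bopBE !innerBl mulN1r opprB.
Qed.

Lemma increases_to_close A W (s : seq H) (e : R[i]) :
  increases_to A W -> 0 < e ->
  exists2 S, A S & forall x, x \in s -> `|W x - S x| < e.
Proof.
move=> [[[S0 AS0] Adir] _ _ AW] e0.
suff [S1 AS1 S1s] : exists2 S1, A S1 &
    forall S, A S -> bop_le S1 S -> forall x, x \in s -> `|W x - S x| < e.
  by exists S1 => // x; apply: S1s => //; exact: bop_le_refl.
elim: s => [|x s [S1 AS1 S1s]]; first by exists S0.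
have [S2 AS2 S2x] := AW x e e0.
have [S3 [AS3 S13 S23]] := Adir _ _ AS1 AS2.
exists S3 => // S AS S3S y; rewrite inE => /predU1P[->|ys].
  by apply: S2x => //; exact: bop_le_trans S3S.
by apply: S1s => //; exact: bop_le_trans S3S.
Qed.

Lemma increases_to_bicommutant A W : increases_to A W ->
  commutant (commutant A) W.
Proof.
move=> AW; apply: bicommutant_sot_closed => x y e e0.
have [S AS h] := increases_to_close [:: x; y] AW e0.
by exists S; split; rewrite ?h// !inE eqxx ?orbT.
Qed.

(** Zorn's lemma; chains have strong limits, so closure under increasing limits
    is all that has to be checked. *)
Lemma maximal_element (P : set (bop H)) B T0 : P T0 ->
  (forall S, P S -> bop_le S B) ->
  (forall A W, A `<=` P -> increases_to A W -> P W) ->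
  exists2 M, P M & forall T, P T -> bop_le M T -> T = M.
Proof.
move=> PT0 PB Plim.
pose X := {T : bop H | P T}.
have [] := @Zorn X (fun S T : X => `[< bop_le (sval S) (sval T) >]).
- by move=> S; apply/asboolP; exact: bop_le_refl.
- move=> S T U /asboolP ST /asboolP TU; apply/asboolP.
  exact: bop_le_trans TU.
- move=> S T /asboolP ST /asboolP TS; apply: eq_sig_hprop.
    by move=> x p q; exact: Prop_irrelevance.
  exact: bop_le_anti.
- move=> A Atot; have [[S0 AS0]|A0] := pselect (A !=set0); last first.
    by exists (exist _ _ PT0) => S AS; case: A0; exists S.
  have [||W WP] := @monotone_limit [set sval S | S in A] B.
  + split; first by exists (sval S0), S0.
    move=> _ _ [S AS <-] [T AT <-].
    have [/asboolP ST|/asboolP TS] := Atot S T AS AT.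
      by exists (sval T); split=> //; [exists T|exact: bop_le_refl].
    by exists (sval S); split=> //; [exists S|exact: bop_le_refl].
  + by move=> _ [S AS <-]; apply/PB/(svalP S).
  have PW : P W by apply: Plim WP => _ [S AS <-]; exact: svalP S.
  exists (exist _ _ PW) => S AS; apply/asboolP => /=.
  by have [_ + _ _] := WP; apply; exists S.
move=> [M PM] Mmax; exists M => // T PT MT.
by have /(congr1 sval) := Mmax (exist _ _ PT) (asboolT MT).
Qed.

End operators.
(** * Square roots and unitaries in a von Neumann algebra *)

Section square_roots.
Variables (R : realType) (H : hilbertType R).
Implicit Types (v : H) (S T U W a u x : bop H) (A N : set (bop H)).

Definition bop_exp a n : bop H := iter n (bopM a) (bop1 H).

Lemma bop_expD a m n : bop_exp a (m + n) = bopM (bop_exp a m) (bop_exp a n).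
Proof. by elim: m => [|m IH]; rewrite ?bop1M// addSn /= IH bopMA. Qed.

Lemma bop_expSr a n : bop_exp a n.+1 = bopM (bop_exp a n) a.
Proof. by rewrite -addn1 bop_expD /= bopM1. Qed.

Lemma bop_exp_ge0 a n : bop_le 0 a -> bop_le 0 (bop_exp a n).
Proof.
move=> a0; suff [] : bop_le 0 (bop_exp a n) /\ bop_le 0 (bop_exp a n.+1) by [].
elim: n => [|n [IH1 IH2]].
  split; last by rewrite /= bopM1.
  by apply/bop_ge0E => v; rewrite /= innerxx exprn_ge0.
split=> //; apply/bop_ge0E => v.
  rewrite -[bop_exp a n.+2]/(bopM a (bop_exp a n.+1)).
rewrite bop_expSr !bopME adjP (adj_ge0 a0).
by have /bop_ge0E := IH1; apply.
Qed.

Lemma bicommutant1_comm a S T : commutant (commutant [set a]) S ->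
  commutant (commutant [set a]) T -> bopM S T = bopM T S.
Proof.
move=> aS aT; apply: aT; move: S aS.
by apply: commutantS => U ->{U} U ->.
Qed.

Lemma sub_bicommutant1 N a : von_neumann N -> N a ->
  commutant (commutant [set a]) `<=` N.
Proof.
move=> vN Na T aT; apply: vn_bicomm => //; move: T aT.
by apply/commutantS/commutantS => T ->.
Qed.

(** Values at [a] of polynomials with nonnegative coefficients. They are
    positive because powers of a positive operator are, whereas positivity of
    a product of commuting positive operators already needs square roots. *)
Definition ge0_poly a T := exists2 s : seq (R[i] * nat),
  all (fun p => 0 <= p.1) s & T = \sum_(p <- s) p.1 *: bop_exp a p.2.

Lemma ge0_polyX a n : ge0_poly a (bop_exp a n).
Proof. by exists [:: (1, n)]; rewrite /= ?ler01// big_seq1 scale1r. Qed.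

Lemma ge0_poly0 a : ge0_poly a 0.
Proof. by exists [::]; rewrite // big_nil. Qed.

Lemma ge0_polyD a S T : ge0_poly a S -> ge0_poly a T -> ge0_poly a (S + T).
Proof.
move=> [s s0 ->] [t t0 ->]; exists (s ++ t); first by rewrite all_cat s0.
by rewrite big_cat.
Qed.

Lemma ge0_polyZ a c T : 0 <= c -> ge0_poly a T -> ge0_poly a (c *: T).
Proof.
move=> c0 [s s0 ->]; exists [seq (c * p.1, p.2) | p <- s].
  by rewrite all_map; apply: sub_all s0 => p /= p0; rewrite mulr_ge0.
by rewrite big_map scaler_sumr; apply: eq_bigr => p _; rewrite scalerA.
Qed.

Lemma ge0_polyMX a n T : ge0_poly a T -> ge0_poly a (bopM (bop_exp a n) T).
Proof.
move=> [s s0 ->]; exists [seq (p.1, n + p.2)%N | p <- s].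
  by rewrite all_map; apply: sub_all s0 => p.
rewrite big_map; apply: bop_ext => v; rewrite bopME !bop_sumE bop_sum.
by apply: eq_bigr => p _; rewrite !bopE bopZ bop_expD.
Qed.

Lemma ge0_polyM a S T : ge0_poly a S -> ge0_poly a T -> ge0_poly a (bopM S T).
Proof.
move=> [s s0 ->] aT; elim: s s0 => [_|p s IH /= /andP[p0 s0]].
  by rewrite big_nil bop0M; exact: ge0_poly0.
rewrite big_cons bopMDl bopMZl; apply: ge0_polyD; last exact: IH.
exact/ge0_polyZ/ge0_polyMX.
Qed.

Lemma ge0_poly_ge0 a T : bop_le 0 a -> ge0_poly a T -> bop_le 0 T.
Proof.
move=> a0 [s s0 ->]; apply/bop_ge0E => v.
elim: s s0 => [_|p s IH /= /andP[p0 s0]]; first by rewrite big_nil inner0l.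
rewrite big_cons bopDE innerDl addr_ge0 ?IH//.
rewrite bopZE innerZl mulr_ge0//.
by have /bop_ge0E := bop_exp_ge0 p.2 a0; apply.
Qed.

Lemma ge0_poly_bicommutant a T : ge0_poly a T ->
  commutant (commutant [set a]) T.
Proof.
have aX n : commutant (commutant [set a]) (bop_exp a n).
  elim: n => [|n IH]; first exact: commutant1.
  by apply: commutantM => //; exact: sub_bicommutant.
move=> [s _ ->]; elim: s => [|p s IH]; last first.
  by rewrite big_cons; exact: commutant_lin.
by rewrite big_nil; exact: commutant0.
Qed.

(** The iteration [y' = (a + y^2) / 2] from [0] increases to a solution of
    [(1 - y)^2 = 1 - a]. *)
Fixpoint sqrt_iter a n : bop H :=
  if n is m.+1 then 2^-1 *: (a + bopM (sqrt_iter a m) (sqrt_iter a m)) else 0.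

Lemma sqrt_iter_poly a n : ge0_poly a (sqrt_iter a n).
Proof.
elim: n => [|n IH] /=; first exact: ge0_poly0.
apply: ge0_polyZ; first by rewrite invr_ge0.
apply: ge0_polyD; last exact: ge0_polyM.
by have := ge0_polyX a 1; rewrite /= bopM1.
Qed.

Lemma sqrt_iter_comm a m n : bopM (sqrt_iter a m) (sqrt_iter a n) =
  bopM (sqrt_iter a n) (sqrt_iter a m).
Proof.
by apply: (@bicommutant1_comm a); exact/ge0_poly_bicommutant/sqrt_iter_poly.
Qed.

Lemma sqrt_iter_incr_poly a n : ge0_poly a (sqrt_iter a n.+1 - sqrt_iter a n).
Proof.
elim: n => [|n IH].
  rewrite subr0 /= bopM0 addr0; apply: ge0_polyZ; first by rewrite invr_ge0.
  by have := ge0_polyX a 1; rewrite /= bopM1.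
have -> : sqrt_iter a n.+2 - sqrt_iter a n.+1 =
   2^-1 *: bopM (sqrt_iter a n.+1 - sqrt_iter a n)
                (sqrt_iter a n.+1 + sqrt_iter a n).
  rewrite -[sqrt_iter a n.+2]/(2^-1 *: (a + bopM (sqrt_iter a n.+1)
    (sqrt_iter a n.+1))).
  rewrite [in X in _ - X]/= -scalerBr; congr (_ *: _).
  rewrite bopMBl !bopMDr (sqrt_iter_comm a n n.+1) addrKA.
  by rewrite [a + _]addrC addrKA.
apply: ge0_polyZ; first by rewrite invr_ge0.
by apply: ge0_polyM => //; apply: ge0_polyD; exact: sqrt_iter_poly.
Qed.

Lemma sqrt_iter_mono a m n : bop_le 0 a -> (m <= n)%N ->
  bop_le (sqrt_iter a m) (sqrt_iter a n).
Proof.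
move=> a0 /subnK <-; elim: (n - m)%N => [|k IH]; first exact: bop_le_refl.
apply: bop_le_trans IH _; apply/bop_leB0.
exact/ge0_poly_ge0/sqrt_iter_incr_poly.
Qed.

Lemma sqrt_iter_norm a n v : (forall w, `|a w| <= `|w|) ->
  `|sqrt_iter a n v| <= `|v|.
Proof.
move=> a1; elim: n v => [|n IH] v; first by rewrite normr0.
rewrite [sqrt_iter _ _]/= !bopE normrZ ger0_norm ?invr_ge0//.
rewrite ler_pdivrMl// mulrC mulr_natr mulr2n (le_trans (ler_normD _ _))//.
by rewrite lerD// (le_trans (IH _))// IH.
Qed.

Lemma ge0_le1_norm a : bop_le 0 a -> bop_le a (bop1 H) ->
  forall v, `|a v| <= `|v|.
Proof.
move=> a0 /bop_leE a1 v; rewrite -(@ler_pXn2r _ 2) ?nnegrE//.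
have aq w : inner (a w) w <= 1 * `|w| ^+ 2 by rewrite mul1r -innerxx; exact: a1.
by rewrite (le_trans (ge0_norm_sqr_le a0 ltr01 aq v))// mul1r -[leRHS]mul1r.
Qed.

Lemma norm_le1_le1 T : bop_le 0 T -> (forall v, `|T v| <= `|v|) ->
  bop_le T (bop1 H).
Proof.
move=> /bop_ge0E T0 T1; apply/bop_leE => v.
rewrite -(ger0_norm (T0 v)) (le_trans (CauchySchwarz _ _))//.
by rewrite bop1E innerxx expr2 ler_wpM2r.
Qed.

Lemma sqrt_iter_limit a : bop_le 0 a -> bop_le a (bop1 H) ->
  exists2 W, increases_to (range (sqrt_iter a)) W &
    W + W = a + bopM W W.
Proof.
move=> a0 a1; have an := ge0_le1_norm a0 a1.
have y0 n : bop_le 0 (sqrt_iter a n) by exact: (sqrt_iter_mono (m := 0)).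
have [||W AW] := @monotone_limit _ _ (range (sqrt_iter a)) (bop1 H).
- split; first by exists (sqrt_iter a 0), 0%N.
  move=> _ _ [m _ <-] [n _ <-]; exists (sqrt_iter a (maxn m n)).
  split; first by exists (maxn m n).
    by apply: sqrt_iter_mono => //; exact: leq_maxl.
  by apply: sqrt_iter_mono => //; exact: leq_maxr.
- by move=> _ [n _ <-]; apply: norm_le1_le1 => // v; exact: sqrt_iter_norm.
exists W => //; apply: bop_ext => v; apply/subr0_eq.
apply: (@eps_vec_eq0 _ _ _ (2 + 2)) => [|e e0]; first by rewrite addr_ge0.
have lim w : exists m, forall n, (m <= n)%N -> `|W w - sqrt_iter a n w| < e.
  have [_ _ _ /(_ w e e0)[_ [m _ <-] mP]] := AW.
  by exists m => k mk; apply: mP; [exists k|exact: sqrt_iter_mono].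
have [m1 v1] := lim v; have [m2 v2] := lim (W v).
pose k := maxn m1 m2; pose y := sqrt_iter a k.
have {v2} v2 : `|W (W v) - y (W v)| < e by rewrite v2// leq_maxr.
have v3 : `|W v - y v| < e by rewrite v1// leq_maxl.
have {v1} v1 : `|W v - sqrt_iter a k.+1 v| < e.
  by rewrite v1// ltnW// ltnS leq_maxl.
have -> : (W + W) v - (a + bopM W W) v =
    2 *: (W v - sqrt_iter a k.+1 v) - (W (W v) - y (W v)) - y (W v - y v).
  rewrite [sqrt_iter a k.+1]/= -/y !bopE !bopB; apply: inner_ext => z.
  by rewrite !(innerDl, innerNl, innerZl); field.
have -> : (2 + 2) * e = 2 * e + e + e by ring.
apply: le_trans (ler_normB _ _) _; apply: lerD; last first.
  by apply: le_trans (sqrt_iter_norm _ _ an) _; exact: ltW.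
apply: le_trans (ler_normB _ _) _; apply: lerD; last exact: ltW.
by rewrite normrZ normr_nat ler_wpM2l// ltW.
Qed.

Lemma ge0_sqrt x : bop_le 0 x -> exists s,
  [/\ commutant (commutant [set x]) s, bop_le 0 s & bopM s s = x].
Proof.
move=> x0; have [c c0 xc] := bop_bounded x.
pose a := bop1 H - c^-1 *: x.
have ci : 0 <= c^-1 by rewrite invr_ge0 ltW.
have x0' := (bop_ge0E _).1 x0.
have a1 : bop_le a (bop1 H).
  apply/bop_leE => v; rewrite bopBE innerBl gerBl bopZE innerZl.
  by rewrite mulr_ge0.
have a0 : bop_le 0 a.
  apply/bop_ge0E => v; rewrite bopBE innerBl subr_ge0 bopZE innerZl.
  rewrite ler_pdivrMl// bop1E innerxx expr2 mulrA.
  rewrite -(ger0_norm (x0' v)) (le_trans (CauchySchwarz _ _))//.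
  by rewrite ler_wpM2r.
have [W AW WE] := sqrt_iter_limit a0 a1.
have W1 : bop_le W (bop1 H).
  have [_ _ + _] := AW; apply=> _ [n _ <-].
  apply: norm_le1_le1; first exact: (sqrt_iter_mono (m := 0)).
  by move=> v; exact/sqrt_iter_norm/ge0_le1_norm.
have aW : commutant (commutant [set a]) W.
  have := increases_to_bicommutant AW.
  rewrite -(@commutant3 _ _ (commutant [set a])).
  apply/commutantS/commutantS => _ [n _ <-].
  exact/ge0_poly_bicommutant/sqrt_iter_poly.
have xW : commutant (commutant [set x]) W.
  move: W aW {AW WE W1}; apply: commutantS => T Tx _ ->.
  have := Tx x erefl => xT.
  by rewrite bopMBl bopMBr bopM1 bop1M bopMZl bopMZr xT.
have cs : sqrtC c * sqrtC c = c by rewrite -expr2 sqrtCK.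
exists (sqrtC c *: (bop1 H - W)); split.
- rewrite scalerBr addrC -scaleNr; apply: commutant_lin => //.
  exact/commutantZ/commutant1.
- apply/bop_ge0E => v; rewrite bopZE innerZl mulr_ge0//.
  by rewrite sqrtC_ge0 ltW.
rewrite bopMZl bopMZr scalerA cs bopMBl !bopMBr !bopM1 bop1M.
have -> : bop1 H - W - (W - bopM W W) = c^-1 *: x.
  have -> : bopM W W = W + W - a by rewrite WE addrAC subrr add0r.
  apply: bop_ext => v; rewrite !bopE; apply: inner_ext => z.
  by rewrite !(innerDl, innerNl, innerZl); ring.
by rewrite scalerA mulfV ?gt_eqF// scale1r.
Qed.

(** ** Linear spans *)

Lemma lin_span_sub A : A `<=` lin_span A.
Proof.
move=> T AT; exists 1%N, (fun=> 1), (fun=> T); split=> //.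
by rewrite big_ord1 scale1r.
Qed.

Lemma lin_span_lin A c S T : lin_span A S -> lin_span A T ->
  lin_span A (c *: S + T).
Proof.
move=> [m [a [u [Au ->]]]] [n [b [v [Av ->]]]].
exists (m + n)%N,
  (fun i : 'I_(m + n) =>
     match fintype.split i with inl j => c * a j | inr j => b j end),
  (fun i : 'I_(m + n) =>
     match fintype.split i with inl j => u j | inr j => v j end).
split=> [i|]; first by case: fintype.split.
rewrite big_split_ord scaler_sumr; congr (_ + _); apply: eq_bigr => i _.
  by rewrite (unsplitK (inl _ i)) scalerA.
by rewrite (unsplitK (inr _ i)).
Qed.

Lemma lin_span_ind A (P : set (bop H)) : P 0 ->
  (forall c S T, P S -> P T -> P (c *: S + T)) -> A `<=` P -> lin_span A `<=` P.
Proof.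
move=> P0 Plin AP _ [n [c [v [Av ->]]]]; elim: n c v Av => [|n IH] c v Av.
  by rewrite big_ord0.
by rewrite big_ord_recl; apply: Plin; [exact/AP/Av|apply: IH => i; exact: Av].
Qed.

Lemma lin_span0 A : lin_span A 0.
Proof.
by exists 0%N, (fun=> 0), (fun=> 0); split=> [[]//|]; rewrite big_ord0.
Qed.

Lemma lin_spanZ A c S : lin_span A S -> lin_span A (c *: S).
Proof.
move=> AS; rewrite -[_ *: _]addr0; apply: lin_span_lin => //.
exact: lin_span0.
Qed.

Lemma lin_spanS A B : A `<=` B -> lin_span A `<=` lin_span B.
Proof.
move=> AB; apply: lin_span_ind; [exact: lin_span0|exact: lin_span_lin|].
by move=> T /AB; exact: lin_span_sub.
Qed.

Definition unitary u := bopM (adj u) u = bop1 H /\ bopM u (adj u) = bop1 H.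

(** A self-adjoint contraction [x] is the real part of the unitary
    [x + i sqrt (1 - x^2)]; scaling and splitting into real and imaginary parts
    do the rest. *)
Lemma vn_unitary_span N : von_neumann N ->
  N `<=` lin_span [set u | N u /\ unitary u].
Proof.
move=> vN.
have contr x : N x -> adj x = x -> (forall v, `|x v| <= `|v|) ->
    lin_span [set u | N u /\ unitary u] x.
  move=> Nx xx x1; pose y := bop1 H - bopM x x.
  have y0 : bop_le 0 y.
    apply/bop_ge0E => v; rewrite bopBE innerBl bop1E bopME adjP xx !innerxx.
    by rewrite subr_ge0 lerXn2r ?nnegrE.
  have [s [ys s0 sy]] := ge0_sqrt y0; have ss := adj_ge0 s0.
  have Ny : N y by apply: (vnB vN); [exact: vn1|exact: vnM].
  have Ns : N s by exact: sub_bicommutant1 ys.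
  have xs : bopM x s = bopM s x.
    apply: ys => _ ->; rewrite /y bopMBl bopMBr bopM1 bop1M bopMA//.
  have N1 : N (x + 'i *: s) by rewrite addrC; exact: vn_lin.
  have a1 : adj (x + 'i *: s) = x - 'i *: s.
    by rewrite adjD adjZ xx ss conjCi scaleNr.
  have U1 : bopM (x - 'i *: s) (x + 'i *: s) = bop1 H.
    rewrite bopMBl !bopMDr !bopMZl !bopMZr xs sy scalerA -expr2 sqrCi scaleN1r.
    by rewrite /y addrKA opprK addrC subrK.
  have U2 : bopM (x + 'i *: s) (x - 'i *: s) = bop1 H.
    rewrite bopMDl !bopMBr !bopMZl !bopMZr xs sy scalerA -expr2 sqrCi scaleN1r.
    by rewrite /y addrA subrK opprK addrC subrK.
  have -> : x = 2^-1 *: (x + 'i *: s) + (2^-1 *: (x - 'i *: s) + 0).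
    apply: bop_ext => v; rewrite !bopE; apply: inner_ext => z.
    by rewrite !(innerDl, innerNl, innerZl, inner0l); field.
  apply: lin_span_lin.
    by apply: lin_span_sub; split=> //; split; rewrite a1.
  apply: lin_span_lin; last exact: lin_span0.
  apply: lin_span_sub; rewrite -a1; split; first exact: vn_adj.
  by split; rewrite adjK a1.
have sa x : N x -> adj x = x -> lin_span [set u | N u /\ unitary u] x.
  move=> Nx xx; have [c c0 xc] := bop_bounded x.
  have -> : x = c *: (c^-1 *: x) by rewrite scalerA mulfV ?gt_eqF// scale1r.
  apply: lin_spanZ; apply: contr => [||v]; first exact: vnZ.
    by rewrite adjZ xx geC0_conj// invr_ge0 ltW.
  rewrite bopZE normrZ ger0_norm ?invr_ge0 ?(ltW c0)//.
  by rewrite ler_pdivrMl// xc.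
move=> x Nx; have Nx' := vn_adj vN Nx.
have -> : x = 2^-1 *: (x + adj x) + (- 2^-1 * 'i) *: ('i *: (x - adj x)).
  rewrite scalerA -mulrA -expr2 sqrCi mulrN1 opprK.
  apply: bop_ext => v; rewrite !bopE; apply: inner_ext => z.
  by rewrite !(innerDl, innerNl, innerZl); field.
apply: lin_span_lin.
  by apply: sa; [exact: vnD|rewrite adjD adjK addrC].
apply: lin_spanZ; apply: sa; first by apply: vnZ => //; exact: vnB.
by rewrite adjZ adjB adjK conjCi scaleNr -scalerN opprB.
Qed.

End square_roots.
(** * Automorphisms: positivity, normality and closedness of the graph *)

Section automorphisms.
Variables (R : realType) (H : hilbertType R).
Variables (N : set (bop H)) (a : bop H -> bop H).
Hypotheses (vN : von_neumann N) (aut : automorphism N a).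
Implicit Types (v w : H) (x y n S T W : bop H) (A : set (bop H)).

Lemma aut_in x : N x -> N (a x).
Proof. by have [[+ _ _] _ _ _] := aut; apply. Qed.

Lemma aut_inj x y : N x -> N y -> a x = a y -> x = y.
Proof.
by have [[_ + _] _ _ _] := aut => /(_ x y) h Nx Ny; apply: h; exact: mem_set.
Qed.

Lemma aut_surj y : N y -> exists2 x, N x & a x = y.
Proof. by have [[_ _ +] _ _ _] := aut; apply. Qed.

Lemma aut_lin c x y : N x -> N y -> a (c *: x + y) = c *: a x + a y.
Proof. by have [_ + _ _] := aut; apply. Qed.

Lemma autM x y : N x -> N y -> a (bopM x y) = bopM (a x) (a y).
Proof. by have [_ _ + _] := aut; apply. Qed.

Lemma aut_adj x : N x -> a (adj x) = adj (a x).
Proof. by have [_ _ _] := aut; apply. Qed.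

Lemma autD x y : N x -> N y -> a (x + y) = a x + a y.
Proof. by move=> Nx Ny; rewrite -[x]scale1r aut_lin// !scale1r. Qed.

Lemma aut0 : a 0 = 0.
Proof.
have N0 := vn0 vN.
by apply: (addrI (a 0)); rewrite -autD// !addr0.
Qed.

Lemma autZ c x : N x -> a (c *: x) = c *: a x.
Proof.
move=> Nx; have N0 := vn0 vN.
by rewrite -[c *: x]addr0 aut_lin// aut0 addr0.
Qed.

Lemma autB x y : N x -> N y -> a (x - y) = a x - a y.
Proof.
by move=> Nx Ny; rewrite addrC -scaleN1r aut_lin// scaleN1r addrC.
Qed.

Lemma aut1 : a (bop1 H) = bop1 H.
Proof.
have N1 := vn1 vN; have [x Nx ax] := aut_surj N1.
by rewrite -{2}ax -[x]bop1M autM// ax bopM1.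
Qed.

Lemma vn_sqrt x : N x -> bop_le 0 x ->
  exists s, [/\ N s, adj s = s & bopM s s = x].
Proof.
move=> Nx x0; have [s [xs s0 ss]] := ge0_sqrt x0.
by exists s; split=> //; [exact: sub_bicommutant1 xs|exact: adj_ge0].
Qed.

Lemma aut_ge0 x : N x -> bop_le 0 x -> bop_le 0 (a x).
Proof.
move=> Nx /(vn_sqrt Nx)[s [Ns sa <-]].
by rewrite autM// -{1}sa aut_adj//; exact: adjM_ge0.
Qed.

Lemma aut_ge0_inv x : N x -> bop_le 0 (a x) -> bop_le 0 x.
Proof.
move=> Nx /(vn_sqrt (aut_in Nx))[s [Ns sa ss]].
have [t Nt at_s] := aut_surj Ns.
have ta : adj t = t.
  by apply: aut_inj => //; [exact: vn_adj|rewrite aut_adj// at_s sa].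
have <- : bopM t t = x.
  by apply: aut_inj => //; [exact: vnM|rewrite autM// at_s].
by rewrite -{1}ta; exact: adjM_ge0.
Qed.

Lemma aut_le x y : N x -> N y -> bop_le x y -> bop_le (a x) (a y).
Proof.
move=> Nx Ny /bop_leB0 xy; apply/bop_leB0; rewrite -autB//.
by apply: aut_ge0 => //; exact: vnB.
Qed.

Lemma aut_le_inv x y : N x -> N y -> bop_le (a x) (a y) -> bop_le x y.
Proof.
move=> Nx Ny /bop_leB0; rewrite -autB// => xy; apply/bop_leB0.
by apply: aut_ge0_inv => //; exact: vnB.
Qed.

Lemma aut_contractive x (c : R[i]) : N x -> 0 <= c ->
  (forall v, `|x v| <= c * `|v|) -> forall v, `|a x v| <= c * `|v|.
Proof.
move=> Nx c0 xc v; have N1 := vn1 vN.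
have Nxx : N (bopM (adj x) x) by apply: (vnM vN) => //; exact: vn_adj.
have : bop_le (bopM (adj x) x) (c ^+ 2 *: bop1 H).
  apply/bop_leE => u; rewrite bopME -adjPr bopZE innerZl !innerxx -exprMn.
  by rewrite lerXn2r ?nnegrE ?mulr_ge0.
move=> /(aut_le Nxx (vnZ vN _ N1)) /bop_leE/(_ v).
rewrite autM//; last exact: vn_adj.
rewrite aut_adj// autZ// aut1 bopME -adjPr bopZE innerZl !innerxx -exprMn.
by rewrite ler_pXn2r ?nnegrE ?mulr_ge0.
Qed.

Lemma increases_to_in A W : A `<=` N -> increases_to A W -> N W.
Proof.
move=> AN /increases_to_bicommutant AW; apply: vn_bicomm => //.
by move: W AW; apply/commutantS/commutantS.
Qed.

(** Automorphisms preserve suprema because they preserve the order both ways;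
    the image net has a strong limit, which has to be that supremum. *)
Lemma aut_increases_to A W : A `<=` N -> increases_to A W ->
  increases_to [set a S | S in A] (a W).
Proof.
move=> AN AW; have NW := increases_to_in AN AW.
have [[[S0 AS0] Adir] AleW Wle _] := AW.
have [||W' AW'] := @monotone_limit _ _ [set a S | S in A] (a W).
- split; first by exists (a S0), S0.
  move=> _ _ [S AS <-] [T AT <-]; have [U [AU SU TU]] := Adir _ _ AS AT.
  by exists (a U); split; [exists U|apply: aut_le; auto|apply: aut_le; auto].
- by move=> _ [S AS <-]; apply: aut_le => //; auto.
suff -> : a W = W' by [].
have NW' : N W'.
  by apply: increases_to_in AW' => _ [S AS <-]; apply: aut_in; auto.
have [V NV aV] := aut_surj NW'.
have [_ AleW' W'le _] := AW'.
apply: bop_le_anti; last first.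
  by apply: W'le => _ [S AS <-]; apply: aut_le; auto.
rewrite -aV; apply: aut_le => //; apply: Wle => S AS.
by apply: aut_le_inv; auto; rewrite aV; apply: AleW'; exists S.
Qed.

(** If [phi(b0) < <b0 xi, xi>] for a positive functional [phi] that is monotone
    on [N], then [phi] is dominated by the vector functional of [xi] on all of
    [0, b] for some nonzero [b <= b0]: remove from [b0] a maximal piece on
    which the opposite inequality holds. *)
Lemma dominated_below (phi : bop H -> R[i]) b0 xi :
  (forall S T, N S -> N T -> bop_le S T -> phi S <= phi T) ->
  (forall S T, N S -> N T -> phi (S + T) = phi S + phi T) ->
  N b0 -> bop_le 0 b0 -> phi b0 < inner (b0 xi) xi ->
  exists b, [/\ N b, bop_le 0 b, bop_le b b0, b <> 0 &
    forall D, N D -> bop_le 0 D -> bop_le D b -> phi D <= inner (D xi) xi].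
Proof.
move=> phi_le phiD Nb0 b0_ge0 phib0; have N0 := vn0 vN.
have phi0 : phi 0 = 0.
  by apply: (addrI (phi 0)); rewrite -phiD// !addr0.
have phi_ge0 T : N T -> bop_le 0 T -> 0 <= phi T.
  by move=> NT T0; rewrite -phi0; exact: phi_le.
pose P := [set T |
  [/\ N T, bop_le 0 T, bop_le T b0 & inner (T xi) xi <= phi T]].
have [|T [_ _ ? _]//|A W AP AW|C [NC C0 Cb0 phiC] Cmax] :=
  @maximal_element _ _ P b0 0.
- by split=> //; [exact: bop_le_refl|rewrite bop0E inner0l phi0].
- have AN : A `<=` N by move=> S /AP[].
  have NW := increases_to_in AN AW.
  have [[[S0 AS0] _] AleW Wle Wlim] := AW.
  split=> //.
  + by have [_ + _ _] := AP _ AS0 => /bop_le_trans; apply; exact: AleW.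
  + by apply: Wle => S /AP[].
  rewrite -subr_ge0; apply: (@ge0_eps _ _ `|xi|) => // e e0.
  have [S AS Sxi] := Wlim xi e e0.
  have [NS _ _ phiS] := AP _ AS.
  exists (phi W - inner (S xi) xi).
    by rewrite subr_ge0 (le_trans phiS)// phi_le//; exact: AleW.
  rewrite opprB addrC addrA subrK -innerBl (le_trans (CauchySchwarz _ _))//.
  rewrite mulrC ler_wpM2l// distrC; apply/ltW/Sxi => //.
  exact: bop_le_refl.
have Nb : N (b0 - C) by exact: vnB.
exists (b0 - C); split=> //.
- exact: (bop_leB0 _ _).1.
- by apply/bop_leB0; rewrite opprB addrCA subrr addr0.
- move=> /subr0_eq b0C; rewrite -b0C in phiC;
  by have := lt_le_trans phib0 phiC; rewrite ltxx.
move=> D ND D0 Db.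
have phiDr := phi_ge0 _ ND D0; have Dxi := (bop_ge0E _).1 D0 xi.
rewrite real_leNgt ?ger0_real//; apply/negP => Dphi.
have /eqP : C + D = C.
  apply: Cmax.
    split; first exact: vnD.
    - apply: bop_le_trans C0 _; apply/bop_leB0.
      by rewrite addrAC subrr add0r.
    - apply/bop_leB0; rewrite opprD addrA; exact: (bop_leB0 _ _).1.
    by rewrite bopDE innerDl phiD// lerD// ltW.
  by apply/bop_leB0; rewrite addrAC subrr add0r.
rewrite -subr_eq0 addrAC subrr add0r => /eqP D00.
by move: Dphi; rewrite D00 bop0E inner0l phi0 ltxx.
Qed.

(** Apply the previous lemma to [phi T = <a T eta, eta>]: on the small element
    [b], convergence of [n] to [0] at [b xi] forces convergence of [a n] to [0]
    at [a b eta], since [b n^* n b] is below a multiple of [b]. *)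
Lemma aut_graph0_local y eta b0 : N b0 -> bop_le 0 b0 -> b0 <> 0 ->
  (forall v w (e : R[i]), 0 < e -> exists n,
     [/\ N n, `|n v| < e & `|y w - a n w| < e]) ->
  exists b, [/\ N b, bop_le 0 b, bop_le b b0, b <> 0 & y (a b eta) = 0].
Proof.
move=> Nb0 b0_ge0 b0_neq0 yn.
pose phi T := inner (a T eta) eta.
have phi_ge0 T : N T -> bop_le 0 T -> 0 <= phi T.
  by move=> NT /(aut_ge0 NT)/bop_ge0E; apply.
have [xi0 xi0P] : exists xi0, inner (b0 xi0) xi0 <> 0.
  by apply/existsNP => h; apply/b0_neq0/quadratic_form_eq0.
have q0 : 0 < inner (b0 xi0) xi0.
  by rewrite lt_def (bop_ge0E _).1// andbT; apply/eqP.
pose t := phi b0 / inner (b0 xi0) xi0 + 1.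
have t1 : 1 <= t by rewrite lerDr divr_ge0 ?phi_ge0// ltW.
have t0 : 0 <= t by exact: le_trans t1.
have phib0 : phi b0 < inner (b0 (t *: xi0)) (t *: xi0).
  rewrite bopZ innerZl innerZr geC0_conj// mulrA.
  apply: (@lt_le_trans _ _ (t * inner (b0 xi0) xi0)).
    by rewrite mulrDl mul1r divfK ?gt_eqF// ltrDl.
  by rewrite ler_pM2r// ler_peMr.
have [|S T NS NT|b [Nb b_ge0 bb0 b_neq0 phib]] :=
    @dominated_below phi b0 (t *: xi0) _ _ Nb0 b0_ge0 phib0.
- by move=> S T NS NT /(aut_le NS NT)/bop_leE; apply.
- by rewrite /phi autD// bopDE innerDl.
exists b; split=> //; move: (t *: xi0) phib => xi phib.
have ba := adj_ge0 b_ge0.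
have dom n : N n -> `|a n (a b eta)| <= `|n (b xi)|.
  move=> Nn; have [cn cn0 nc] := bop_bounded n.
  have [cb cb0 bc] := bop_bounded b.
  pose D := bopM (adj (bopM n b)) (bopM n b).
  have Nnb : N (bopM n b) by exact: vnM.
  have ND : N D by apply: (vnM vN) => //; exact: vn_adj.
  pose k := cn ^+ 2 * cb; have k0 : 0 < k by rewrite mulr_gt0 ?exprn_gt0.
  have D0 : bop_le 0 D by exact: adjM_ge0.
  have Dq v : inner (D v) v = `|n (b v)| ^+ 2.
    by rewrite /D bopME -adjPr bopME innerxx.
  have : phi (k^-1 *: D) <= inner ((k^-1 *: D) xi) xi.
    apply: phib; first exact: vnZ.
      apply/bop_ge0E => v; rewrite bopZE innerZl mulr_ge0//.
        by rewrite invr_ge0 ltW.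
      exact: (bop_ge0E _).1.
    apply/bop_leE => v; rewrite bopZE innerZl ler_pdivrMl// Dq.
    have h : `|n (b v)| ^+ 2 <= cn ^+ 2 * `|b v| ^+ 2.
      by rewrite -exprMn lerXn2r ?nnegrE ?mulr_ge0 ?(ltW cn0).
    apply: (le_trans h); rewrite -[leRHS]mulrA ler_pM2l ?exprn_gt0//.
    apply: ge0_norm_sqr_le => // u.
    rewrite -(ger0_norm ((bop_ge0E _).1 b_ge0 u)).
    by rewrite (le_trans (CauchySchwarz _ _))// expr2 mulrA ler_wpM2r.
  rewrite /phi autZ// !bopZE !innerZl ler_pM2l ?invr_gt0// Dq /D.
  rewrite autM ?aut_adj ?autM//; last exact: vn_adj.
  rewrite bopME -adjPr innerxx bopME.
  by rewrite ler_pXn2r ?nnegrE.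
apply: (@eps_vec_eq0 _ _ _ 2) => // e e0.
have [n [Nn nv nw]] := yn (b xi) (a b eta) e e0.
rewrite -[y _](subrK (a n (a b eta))) (le_trans (ler_normD _ _))//.
have -> : 2 * e = e + e by ring.
by rewrite lerD// ltW// (le_lt_trans (dom n Nn)).
Qed.

(** Among the [T] in [[0, 1]] with [y (a T eta) = 0] there is a maximal one;
    unless it is 1, the previous lemma makes it larger. *)
Lemma aut_graph0 y :
  (forall v w (e : R[i]), 0 < e -> exists n,
     [/\ N n, `|n v| < e & `|y w - a n w| < e]) -> y = 0.
Proof.
move=> yn; apply: bop_ext => eta; rewrite bop0E; have N1 := vn1 vN.
have N0 := vn0 vN.
pose P := [set T | [/\ N T, bop_le 0 T, bop_le T (bop1 H) & y (a T eta) = 0]].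
have [|T [_ _ ? _]//|A W AP AW|M [NM M0 M1 yM] Mmax] :=
  @maximal_element _ _ P (bop1 H) 0.
- split=> //; [exact: bop_le_refl| |by rewrite aut0 bop0].
  by apply/bop_ge0E => v; rewrite bop1E innerxx exprn_ge0.
- have AN : A `<=` N by move=> S /AP[].
  have NW := increases_to_in AN AW.
  have [[[S0 AS0] _] AleW Wle Wlim] := AW.
  split=> //.
  + by have [_ + _ _] := AP _ AS0 => /bop_le_trans; apply; exact: AleW.
  + by apply: Wle => S /AP[].
  have [c c0 yc] := bop_bounded y.
  apply: (@eps_vec_eq0 _ _ _ c) => [|e e0]; first exact: ltW.
  have [_ [S AS <-] Sclose] := increases_to_close [:: eta]
    (aut_increases_to AN AW) e0.
  have [_ _ _ yS] := AP _ AS.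
  rewrite -[y _]subr0 -yS -bopB (le_trans (yc _))// ler_pM2l//.
  by rewrite ltW// Sclose// inE.
have [M1'|M1'] := pselect (bop1 H - M = 0).
  by move: yM; rewrite -(subr0_eq M1') aut1.
have [||b [Nb b0 b1 b_neq0 yb]] :=
  @aut_graph0_local y eta (bop1 H - M) _ _ M1' yn.
- exact: vnB.
- exact: (bop_leB0 _ _).1.
case: b_neq0; suff /eqP : M + b = M.
  by rewrite -subr_eq0 addrAC subrr add0r => /eqP.
have Mb : bop_le M (M + b) by apply/bop_leB0; rewrite addrAC subrr add0r.
apply: Mmax => //; split; first exact: vnD.
- exact: bop_le_trans Mb.
- by apply/bop_leB0; rewrite opprD addrA; exact: (bop_leB0 _ _).1.
by rewrite autD// bopDE bopD yM yb addr0.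
Qed.

(** By linearity, limits of the form [(0, y)] are the only ones to treat. *)
Lemma aut_graph_closed x y : N x ->
  (forall v w (e : R[i]), 0 < e -> exists n,
     [/\ N n, `|x v - n v| < e & `|y w - a n w| < e]) -> y = a x.
Proof.
move=> Nx xyn; apply/subr0_eq/aut_graph0 => v w e e0.
have [n [Nn nv nw]] := xyn v w e e0.
exists (n - x); split; first exact: vnB.
  by rewrite bopBE distrC.
by rewrite autB// !bopBE opprB addrA subrK.
Qed.

End automorphisms.
(** * Operators on l2-sums and the density theorem *)

Section l2_operators.
Variables (R : realType) (I : choiceType) (K : hilbertType R).
Implicit Types (i j : I) (v w : K) (f g : l2 I K).
Implicit Types (S T : bop K) (Q : bop (l2 I K)).

Lemma l2_ext f g : (forall i, f i = g i) -> f = g.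
Proof. by move=> fg; apply/val_inj/funext. Qed.

Lemma l2_sumE (J : Type) (s : seq J) (F : J -> l2 I K) i :
  (\sum_(k <- s) F k) i = \sum_(k <- s) F k i.
Proof. by elim: s => [|k s IH]; rewrite ?big_nil// !big_cons l2DE IH. Qed.

Lemma l2_norm_ge f i : `|f i| <= `|f|. Proof. exact: l2norm_ge. Qed.

Lemma delta_subproof i v :
  (fun j => if j == i then v else 0) \in @square_summable R I K.
Proof.
apply/asboolP; exists (`|v| ^+ 2) => J.
have [iJ|iJ] := boolP (i \in J).
  rewrite (big_fsetD1 i)//= eqxx big1_seq ?addr0// => j.
  by rewrite !inE => /andP[_ /andP[/negPf ->]]; rewrite normr0 expr0n.
rewrite big1_seq ?exprn_ge0// => j /andP[_ jJ].
case: eqP => [ji|_]; last by rewrite normr0 expr0n.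
by rewrite -ji jJ in iJ.
Qed.

Definition delta i v : l2 I K := L2 (delta_subproof i v).

Lemma deltaE i v j : delta i v j = if j == i then v else 0.
Proof. by []. Qed.

Lemma delta_id i v : delta i v i = v. Proof. by rewrite deltaE eqxx. Qed.

Lemma inner_delta f i v : inner f (delta i v) = inner (f i) v.
Proof.
apply: l2inner_eq; apply/cvgrPdist_lt => e e0.
exists [fset i]%fset => // J /= iJ.
rewrite partial_sumE (big_fsetD1 i) /=; last first.
  by apply: (fsubsetP iJ); rewrite inE.
rewrite eqxx big1_seq ?addr0 ?subrr ?normr0// => j.
by rewrite !inE => /andP[_ /andP[/negPf -> _]]; rewrite inner0r.
Qed.

Lemma inner_deltal f i v : inner (delta i v) f = inner v (f i).
Proof. by rewrite innerC inner_delta -innerC. Qed.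

Lemma norm_delta i v : `|delta i v| = `|v|.
Proof.
apply: (@pexpIrn _ 2) => //; rewrite ?nnegrE//.
by rewrite -!innerxx inner_delta delta_id.
Qed.

Lemma delta_lin i c v w : delta i (c *: v + w) = c *: delta i v + delta i w.
Proof.
apply: l2_ext => j; rewrite l2DE l2ZE !deltaE.
by case: eqP => // _; rewrite scaler0 addr0.
Qed.

Lemma entry_exists Q i j : exists T : bop K, forall v, T v = Q (delta j v) i.
Proof.
have [c c0 Qc] := bop_bounded Q.
apply: (@bop_of _ _ (fun v => Q (delta j v) i) c); first 2 last.
- move=> v; rewrite -(norm_delta j v).
  exact: le_trans (l2_norm_ge _ _) (Qc _).
- by move=> b v w; rewrite delta_lin bop_linear l2DE l2ZE.
- exact: ltW.
Qed.

Definition entry Q i j : bop K := projT1 (cid (entry_exists Q i j)).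

Lemma entryE Q i j v : entry Q i j v = Q (delta j v) i.
Proof. exact: (projT2 (cid (entry_exists Q i j))). Qed.

Lemma entry_adj Q i j v w :
  inner (entry Q i j v) w = inner v (adj Q (delta i w) j).
Proof. by rewrite entryE -inner_delta adjP inner_deltal. Qed.

Lemma entry_ext Q Q' : (forall i j, entry Q i j = entry Q' i j) -> Q = Q'.
Proof.
move=> QQ'; apply: bop_ext => f; apply: l2_ext => i; apply: inner_ext => w.
rewrite -!inner_delta !adjP; congr (inner f _); apply: l2_ext => j.
apply: inner_ext => v; rewrite innerC -entry_adj QQ' entry_adj.
by rewrite -innerC.
Qed.

Lemma entry_lin c Q Q' i j :
  entry (c *: Q + Q') i j = c *: entry Q i j + entry Q' i j.
Proof. by apply: bop_ext => v; rewrite !bopE !entryE !bopE l2DE l2ZE. Qed.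

Lemma entry0 i j : entry 0 i j = 0.
Proof. by apply: bop_ext => v; rewrite entryE. Qed.

Lemma diag_exists (D : I -> bop K) c : 0 <= c ->
  (forall i v, `|D i v| <= c * `|v|) ->
  exists T : bop (l2 I K), forall f i, T f i = D i (f i).
Proof.
move=> c0 Dc.
have bnd f (J : {fset I}) : \sum_(i <- J) `|D i (f i)| ^+ 2 <= (c * `|f|) ^+ 2.
  rewrite exprMn -(innerxx f).
  have [/(_ J) h _] := l2inner_lub f.
  apply: (@le_trans _ _ (c ^+ 2 * \sum_(i <- J) `|f i| ^+ 2)).
    rewrite mulr_sumr; apply: ler_sum => i _.
    by rewrite -exprMn lerXn2r ?nnegrE ?mulr_ge0.
  by rewrite ler_wpM2l ?exprn_ge0.
have sq f : (fun i => D i (f i)) \in @square_summable R I K.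
  by apply/asboolP; exists ((c * `|f|) ^+ 2) => J; exact: bnd.
have [||T TE] := @bop_of _ _ (fun f => L2 (sq f) : l2 I K) c _ c0.
- move=> a f g; apply: l2_ext => i; rewrite l2DE l2ZE /=.
  by rewrite bop_linear.
- by move=> f; apply: l2norm_le => [|J]; [rewrite mulr_ge0|exact: bnd].
by exists T => f i; rewrite TE.
Qed.

Lemma amp_exists S : exists T : bop (l2 I K), forall f i, T f i = S (f i).
Proof.
have [c c0 Sc] := bop_bounded S.
by apply: (@diag_exists (fun=> S) c) => //; exact: ltW.
Qed.

(** The ampliation [1 (x) S]. *)
Definition amp S : bop (l2 I K) := projT1 (cid (amp_exists S)).

Lemma ampE S f i : amp S f i = S (f i).
Proof. exact: (projT2 (cid (amp_exists S))). Qed.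

Lemma amp_delta S i v : amp S (delta i v) = delta i (S v).
Proof.
apply: l2_ext => j; rewrite ampE !deltaE.
by case: eqP => // _; rewrite bop0.
Qed.

Lemma amp_lin c S T : amp (c *: S + T) = c *: amp S + amp T.
Proof.
by apply: bop_ext => f; apply: l2_ext => i; rewrite !bopE l2DE l2ZE !ampE.
Qed.

Lemma amp0 : amp 0 = 0.
Proof. by apply: bop_ext => f; apply: l2_ext => i; rewrite ampE. Qed.

Lemma amp1 : amp (bop1 K) = bop1 (l2 I K).
Proof. by apply: bop_ext => f; apply: l2_ext => i; rewrite ampE. Qed.

Lemma ampM S T : amp (bopM S T) = bopM (amp S) (amp T).
Proof. by apply: bop_ext => f; apply: l2_ext => i; rewrite !bopE !ampE. Qed.

Lemma amp_adj S : adj (amp S) = amp (adj S).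
Proof.
apply: bop_ext => f; apply: l2_ext => i; apply: inner_ext => v.
by rewrite -inner_delta -adjPr amp_delta inner_delta ampE -adjPr.
Qed.

Lemma amp_commP S Q : bopM (amp S) Q = bopM Q (amp S) <->
  forall i j, bopM S (entry Q i j) = bopM (entry Q i j) S.
Proof.
split=> [SQ i j|SQ].
  apply: bop_ext => v; rewrite !bopE !entryE -ampE -amp_delta.
  by rewrite -[LHS]/(bopM (amp S) Q (delta j v) i) SQ.
apply: entry_ext => i j; apply: bop_ext => v.
have := congr1 (fun X : bop K => X v) (SQ i j).
by rewrite !bopE !entryE !bopE ampE amp_delta.
Qed.

(** The entries of an operator commuting with the ampliation of [U] lie in the
    commutant of [U], hence commute with [T]. *)
Lemma amp_bicommutant (U : set (bop K)) T : commutant (commutant U) T ->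
  commutant (commutant [set amp S | S in U]) (amp T).
Proof.
move=> UT Q QU; apply/esym/amp_commP => i j; apply/esym/UT => S US.
by apply: (amp_commP _ _).1; apply: QU; exists S.
Qed.

Lemma lin_span_amp (U : set (bop K)) :
  lin_span [set amp S | S in U] `<=` [set amp S | S in lin_span U].
Proof.
apply: lin_span_ind.
- by exists 0; [exact: lin_span0|exact: amp0].
- move=> c _ _ [S US <-] [T UT <-]; exists (c *: S + T); last exact: amp_lin.
  exact: lin_span_lin.
- by move=> _ [S US <-]; exists S => //; exact: lin_span_sub.
Qed.

End l2_operators.

Section density.
Variable R : realType.

Definition star_monoid (K : hilbertType R) (U : set (bop K)) := [/\ U (bop1 K),
  forall S T, U S -> U T -> U (bopM S T) & forall S, U S -> U (adj S)].

(** The projection onto the closure of [U v] commutes with [U]. *)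
Lemma bicommutant_density1 (K : hilbertType R) (U : set (bop K)) T (v : K)
    (e : R[i]) :
  star_monoid U -> commutant (commutant U) T -> 0 < e ->
  exists2 S, lin_span U S & `|T v - S v| < e.
Proof.
move=> [U1 UM Ua] UT e0.
pose X := [set S v | S in lin_span U].
have [||P KP] := @orthogonal_projection _ _ X.
- by exists 0 => //; exact: lin_span0.
- move=> a _ _ [S US <-] [S' US' <-]; exists (a *: S + S') => //.
  exact: lin_span_lin.
have UX u x : U u -> X x -> X (u x).
  move=> Uu [S US <-]; exists (bopM u S) => //.
  move: S US; apply: lin_span_ind.
  - by rewrite /= bopM0; exact: lin_span0.
  - move=> c S S' uS uS' /=; rewrite bopMDr bopMZr; exact: lin_span_lin.
  - by move=> S US; apply: lin_span_sub; exact: UM.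
have UP : commutant U P.
  move=> u Uu; apply: (projection_comm KP) => k; first exact: UX.
  exact/UX/Ua.
have [_ PX PK] := KP.
have Xv : X v by exists (bop1 K) => //; exact: lin_span_sub.
have PTv : P (T v) = T v.
  by have := congr1 (fun Z : bop K => Z v) (UT P UP); rewrite !bopE (PK v).
have [_ [S US <-]] := PX (T v) e e0; rewrite PTv => TS.
by exists S.
Qed.

Lemma star_monoid_amp (I : choiceType) (K : hilbertType R) (U : set (bop K)) :
  star_monoid U -> star_monoid [set amp I S | S in U].
Proof.
move=> [U1 UM Ua]; split.
- by exists (bop1 K) => //; exact: amp1.
- move=> _ _ [S US <-] [T UT <-]; exists (bopM S T); last exact: ampM.
  exact: UM.
- by move=> _ [S US <-]; exists (adj S); [exact: Ua|rewrite amp_adj].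
Qed.

(** A finite family of vectors is one vector of an l2-sum. *)
Lemma bicommutant_density (K : hilbertType R) (U : set (bop K)) T (s : seq K)
    (e : R[i]) :
  star_monoid U -> commutant (commutant U) T -> 0 < e ->
  exists2 S, lin_span U S & forall x, x \in s -> `|T x - S x| < e.
Proof.
move=> mU UT e0.
pose xi : l2 nat K := \sum_(i < size s) @delta R nat K i (nth 0 s i).
have xiE k : (k < size s)%N -> xi k = nth 0 s k.
  move=> ks; rewrite l2_sumE (bigD1 (Ordinal ks))//= eqxx big1 ?addr0// => i ik.
  by case: eqP => // ki; case/eqP: ik; apply/val_inj.
have [_ /lin_span_amp[S US <-] TS] := bicommutant_density1 xi
  (star_monoid_amp nat mU) (amp_bicommutant (I := nat) UT) e0.
exists S => // x xs; rewrite -(nth_index 0 xs) -xiE ?index_mem//.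
by rewrite -!ampE; apply: le_lt_trans TS; exact: l2_norm_ge.
Qed.

(** Von Neumann's density theorem for the weak-* topology: normal functionals
    are vector functionals of an ampliation. *)
Lemma bicommutant_weakstar (K : hilbertType R) (U : set (bop K)) T :
  star_monoid U -> commutant (commutant U) T ->
  closure (lin_span U : set (weakstar K)) T.
Proof.
move=> mU UT A; rewrite nbhsE => -[_ [[O Oopen <-] OT] OA].
pose ev (S : bop K) p := normal_functional p S.
have evE p S : ev S p = inner (amp nat S p.1) p.2.
  rewrite -[RHS]/(l2inner _ _) /ev /normal_functional /l2inner; congr (sum _).
  by apply/funext => n; rewrite ampE.
pose F := [set X : set {ptws l2 nat K * l2 nat K -> R[i]^o} |
  exists (s : seq (l2 nat K * l2 nat K)) (e : R[i]), 0 < e /\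
   forall g, (forall p, p \in s -> `|ev T p - g p| < e) -> X g].
have FF : Filter F.
  split=> [|X Y [s [e [e0 sX]]] [s' [e' [e'0 sY]]]|X Y XY [s [e [e0 sX]]]].
  - by exists [::], 1.
  - exists (s ++ s'), (Order.min e e'); split.
      by rewrite comparable_lt_min ?e0// real_comparable ?gtr0_real.
    move=> g gs; split.
      apply: sX => p ps; apply: lt_le_trans (gs p _) _.
        by rewrite mem_cat ps.
      by rewrite comparable_ge_min ?lexx// real_comparable ?gtr0_real.
    apply: sY => p ps; apply: lt_le_trans (gs p _) _.
      by rewrite mem_cat ps orbT.
    by rewrite comparable_ge_min ?lexx ?orbT// real_comparable ?gtr0_real.
  - by exists s, e; split=> // g /sX; exact: XY.
have FT : {ptws, F --> (ev T : _ -> R[i]^o)}.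
  apply/pointwise_cvgP => p; apply/cvgrPdist_lt => e e0.
  by exists [:: p], e; split=> // g; apply; rewrite inE.
have [s [e [e0 sO]]] : F O.
  by apply: FT; exact: open_nbhs_nbhs.
pose d := 1 + \sum_(p <- s) `|p.2|.
have d0 : 0 < d by rewrite ltr_pwDl// sumr_ge0.
have e'0 : 0 < e / d by rewrite divr_gt0.
have [_ /lin_span_amp[S US <-] TS] := bicommutant_density [seq p.1 | p <- s]
  (star_monoid_amp nat mU) (amp_bicommutant (I := nat) UT) e'0.
exists S; split=> //; apply/OA/sO => p ps.
rewrite -/(ev S p) !evE -innerBl.
apply: le_lt_trans (CauchySchwarz _ _) _.
have pd : `|p.2| < d.
  by rewrite /d (big_rem p)//= addrCA ltrDl ltr_pwDl// sumr_ge0.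
have TSp := TS _ (map_f _ ps).
apply: le_lt_trans (_ : _ <= e / d * `|p.2|) _.
  by rewrite ler_wpM2r// ltW.
by rewrite -mulrA gtr_pMr// ltr_pdivrMl// mulr1.
Qed.

End density.
(** * The covariant representation *)

Section covariant_representation.
Variables (R : realType) (H : hilbertType R) (G : groupType).
Variable alpha : G -> bop H -> bop H.
Implicit Types (g h k : G) (v w : H) (f : l2 G H) (x y z n u : bop H).
Implicit Types (S T : bop (l2 G H)).

Definition pi x : bop (l2 G H) := xget 0 [set T | is_pi alpha x T].

Lemma lambda_exists g : exists T : bop (l2 G H), is_lambda g T.
Proof.
have bnd f (J : {fset G}) :
    \sum_(h <- J) `|f (g^-1 * h)%g| ^+ 2 <= `|f| ^+ 2.
  have [/(_ [fset (g^-1 * h)%g | h in J]%fset) le_f _] := l2inner_lub f.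
  rewrite -innerxx; apply: le_trans le_f.
  by rewrite big_imfset /= => [|h h' _ _ /mulgI].
have sq f : (fun h => f (g^-1 * h)%g) \in @square_summable R G H.
  by apply/asboolP; exists (`|f| ^+ 2).
have [|f|T TE] := @bop_of _ _ (fun f => L2 (sq f) : l2 G H) 1 _ ler01.
- by move=> a f f'; apply: l2_ext => h; rewrite l2DE l2ZE.
- by rewrite mul1r; apply: l2norm_le => // J; exact: bnd.
by exists T => f h; rewrite TE.
Qed.

Definition lam g : bop (l2 G H) := projT1 (cid (lambda_exists g)).

Lemma lamE g f h : lam g f h = f (g^-1 * h)%g.
Proof. exact: (projT2 (cid (lambda_exists g))). Qed.

Lemma is_lambdaP g T : is_lambda g T <-> T = lam g.
Proof.
split=> [gT|->]; last exact: lamE.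
by apply: bop_ext => f; apply: l2_ext => h; rewrite gT lamE.
Qed.

Lemma lam_delta g h v : lam g (delta h v) = delta (g * h)%g v.
Proof.
apply: l2_ext => k; rewrite lamE !deltaE.
by rewrite -(inj_eq (@mulgI _ g)) mulVKg.
Qed.

Lemma lam1 : lam 1%g = bop1 _.
Proof.
by apply: bop_ext => f; apply: l2_ext => h; rewrite lamE invg1 mul1g.
Qed.

Lemma lamM g h : bopM (lam g) (lam h) = lam (g * h)%g.
Proof.
by apply: bop_ext => f; apply: l2_ext => k; rewrite bopME !lamE invgM mulgA.
Qed.

Lemma adj_lam g : adj (lam g) = lam g^-1%g.
Proof.
apply: bop_ext => f; apply: l2_ext => h; apply: inner_ext => v.
by rewrite -inner_delta -adjPr lam_delta inner_delta lamE invgK.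
Qed.

Section invariant_algebra.
Variable C : set (bop H).
Hypotheses (vC : von_neumann C) (act : group_action alpha C).

Let autC g : automorphism C (alpha g). Proof. exact: act.1. Qed.

Lemma act_in g x : C x -> C (alpha g x). Proof. exact: (aut_in (autC g)). Qed.

Lemma actM g h x : C x -> alpha (g * h)%g x = alpha g (alpha h x).
Proof. exact: act.2. Qed.

Lemma act_1 x : C x -> alpha 1%g x = x.
Proof.
move=> Cx; apply: (aut_inj (autC 1%g)) => //; first exact: act_in.
by rewrite -actM// mulg1.
Qed.

Lemma piP x : C x -> is_pi alpha x (pi x).
Proof.
move=> Cx; rewrite /pi; case: xgetP => [_ -> //|noT].
have [c c0 xc] := bop_bounded x.
have [|h v|T TE] := @diag_exists _ G _ (fun h => alpha h^-1%g x) c.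
- exact: ltW.
- by apply: (aut_contractive vC (autC _) Cx (ltW c0)).
by case: (noT T).
Qed.

Lemma piE x f h : C x -> pi x f h = alpha h^-1%g x (f h).
Proof. by move=> /piP; apply. Qed.

Lemma canonical_copyP T :
  canonical_copy alpha C T <-> exists2 x, C x & T = pi x.
Proof.
split=> [[x Cx xT]|[x Cx ->]]; exists x => //; last exact: piP.
by apply: bop_ext => f; apply: l2_ext => h; rewrite xT piE.
Qed.

Lemma copy_pi x : C x -> canonical_copy alpha C (pi x).
Proof. by move=> Cx; apply/canonical_copyP; exists x. Qed.

Lemma pi_delta x h v : C x -> pi x (delta h v) = delta h (alpha h^-1%g x v).
Proof.
move=> Cx; apply: l2_ext => k; rewrite piE// !deltaE.
by case: eqP => [->//|_]; rewrite bop0.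
Qed.

Lemma entry_pi_lam x k g h : C x -> entry (bopM (pi x) (lam k)) g h =
  if g == (k * h)%g then alpha g^-1%g x else 0.
Proof.
move=> Cx; apply: bop_ext => v; rewrite entryE bopME lam_delta pi_delta//.
by rewrite deltaE; case: eqP => [->|].
Qed.

Lemma entry_pi x g h : C x ->
  entry (pi x) g h = if g == h then alpha g^-1%g x else 0.
Proof. by move=> Cx; rewrite -[pi x]bopM1 -lam1 entry_pi_lam// mul1g. Qed.

Lemma entry_pi11 x : C x -> entry (pi x) 1%g 1%g = x.
Proof. by move=> Cx; rewrite entry_pi// eqxx invg1 act_1. Qed.

Lemma pi_lin c x y : C x -> C y -> pi (c *: x + y) = c *: pi x + pi y.
Proof.
move=> Cx Cy; apply: bop_ext => f; apply: l2_ext => h.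
rewrite piE; last exact: vn_lin.
by rewrite (aut_lin (autC _))// !bopE l2DE l2ZE !piE.
Qed.

Lemma pi0 : pi 0 = 0.
Proof.
have C0 := vn0 vC; apply: bop_ext => f; apply: l2_ext => h.
by rewrite piE// (aut0 vC (autC _)).
Qed.

Lemma pi1 : pi (bop1 H) = bop1 _.
Proof.
have C1 := vn1 vC; apply: bop_ext => f; apply: l2_ext => h.
by rewrite piE// (aut1 vC (autC _)).
Qed.

Lemma piM x y : C x -> C y -> pi (bopM x y) = bopM (pi x) (pi y).
Proof.
move=> Cx Cy; apply: bop_ext => f; apply: l2_ext => h.
rewrite piE; last exact: vnM.
by rewrite (autM (autC _))// !bopE !piE.
Qed.

Lemma piB x y : C x -> C y -> pi (x - y) = pi x - pi y.
Proof.
move=> Cx Cy; by rewrite addrC -scaleN1r pi_lin// scaleN1r addrC.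
Qed.

Lemma adj_pi x : C x -> adj (pi x) = pi (adj x).
Proof.
move=> Cx; have Cx' := vn_adj vC Cx.
apply: bop_ext => f; apply: l2_ext => h; apply: inner_ext => v.
rewrite -inner_delta -adjPr pi_delta// inner_delta piE//.
by rewrite (aut_adj (autC _))// -adjPr.
Qed.

Lemma pi_ge0 x : C x -> bop_le 0 x -> bop_le 0 (pi x).
Proof.
move=> Cx /(vn_sqrt vC Cx)[s [Cs sa <-]].
by rewrite piM// -{1}sa -adj_pi//; exact: adjM_ge0.
Qed.

Lemma pi_le x y : C x -> C y -> bop_le x y -> bop_le (pi x) (pi y).
Proof.
move=> Cx Cy /bop_leB0 xy; apply/bop_leB0; rewrite -piB//.
by apply: pi_ge0 => //; exact: vnB.
Qed.

Lemma lam_pi g x : C x -> bopM (lam g) (pi x) = bopM (pi (alpha g x)) (lam g).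
Proof.
move=> Cx; apply: bop_ext => f; apply: l2_ext => h.
have Cgx := act_in g Cx.
by rewrite !bopME lamE !piE// lamE -actM// invgM invgK.
Qed.

Lemma star_monoid_copy : star_monoid (canonical_copy alpha C).
Proof.
split.
- by rewrite -pi1; apply: copy_pi; exact: vn1.
- move=> _ _ /canonical_copyP[x Cx ->] /canonical_copyP[y Cy ->].
  by rewrite -piM//; apply: copy_pi; exact: vnM.
- move=> _ /canonical_copyP[x Cx ->]; rewrite adj_pi//.
  by apply: copy_pi; exact: vn_adj.
Qed.

(** The matrices of the form [\sum_k pi (x_k) lambda_k]; they are determined
    by their row of index 1. *)
Definition crossed_matrix S := (forall k, C (entry S 1%g k)) /\
  forall g h, entry S g h = alpha g^-1%g (entry S 1%g (h * g^-1)%g).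

Lemma crossed_matrix0 : crossed_matrix 0.
Proof.
split=> [k|g h]; rewrite !entry0; first exact: vn0.
by rewrite (aut0 vC (autC _)).
Qed.

Lemma crossed_matrix_lin c S T : crossed_matrix S -> crossed_matrix T ->
  crossed_matrix (c *: S + T).
Proof.
move=> [CS ES] [CT ET].
split=> [k|g h]; rewrite !entry_lin; first exact: vn_lin.
by rewrite (aut_lin (autC _))// ES ET.
Qed.

Lemma crossed_matrix_pi_lam x k : C x -> crossed_matrix (bopM (pi x) (lam k)).
Proof.
move=> Cx; split=> [h|g h]; rewrite !entry_pi_lam//.
  by case: ifP => _; [exact: act_in|exact: vn0].
rewrite mulgA -[X in _ = alpha _ (if X then _ else _)](inj_eq (@mulIg _ g)).
rewrite mul1g mulgVK; case: ifP => _; first by rewrite invg1 act_1.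
by rewrite (aut0 vC (autC _)).
Qed.

Lemma crossed_matrix_pi x : C x -> crossed_matrix (pi x).
Proof.
by move=> Cx; rewrite -[pi x]bopM1 -lam1; exact: crossed_matrix_pi_lam.
Qed.

(** Closedness of the graphs of the automorphisms passes the covariance of the
    entries to strong limits. *)
Lemma crossed_matrix_closed (L : set (bop (l2 G H))) T :
  L `<=` crossed_matrix ->
  (forall (s : seq (l2 G H)) (e : R[i]), 0 < e ->
     exists2 S, L S & forall f, f \in s -> `|T f - S f| < e) ->
  crossed_matrix T.
Proof.
move=> Lc LT.
have close g h v g' h' v' (e : R[i]) : 0 < e -> exists2 S, L S &
    `|entry T g h v - entry S g h v| < e /\
    `|entry T g' h' v' - entry S g' h' v'| < e.
  move=> e0; have [S LS TS] := LT [:: delta h v; delta h' v'] e e0.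
  exists S => //; rewrite !entryE -!l2BE.
  by split; (apply: le_lt_trans (l2_norm_ge _ _) _; apply: TS;
    rewrite !inE eqxx ?orbT).
have CT k : C (entry T 1%g k).
  apply: vn_bicomm => //; apply: bicommutant_sot_closed => v w e e0.
  have [S LS [Sv Sw]] := close 1%g k v 1%g k w e e0.
  by exists (entry S 1%g k); split=> //; have [+ _] := Lc _ LS; apply.
split=> // g h; apply: (aut_graph_closed vC (autC _)) => // v w e e0.
have [S LS [Sv Sw]] := close 1%g (h * g^-1)%g v g h w e e0.
have [CS ES] := Lc _ LS.
by exists (entry S 1%g (h * g^-1)%g); split=> //; rewrite -ES.
Qed.

Lemma diagonal_crossed_matrix T : crossed_matrix T ->
  (forall k, k <> 1%g -> entry T 1%g k = 0) -> T = pi (entry T 1%g 1%g).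
Proof.
move=> [CT ET] T0; apply: entry_ext => g h; rewrite entry_pi//.
case: eqP => [<-|gh]; rewrite ET ?mulgV// T0 ?(aut0 vC (autC _))//.
by move=> /divg1_eq hg; apply: gh.
Qed.

(** A strong limit of operators [pi x] is a crossed matrix which is diagonal,
    hence again of this form. *)
Lemma copy_vn : von_neumann (canonical_copy alpha C).
Proof.
have mC := star_monoid_copy.
split; first by case: mC.
apply/seteqP; split; last exact: sub_bicommutant.
move=> T CT.
have LC : lin_span (canonical_copy alpha C) `<=` canonical_copy alpha C.
  apply: lin_span_ind => //; first by rewrite -pi0; apply: copy_pi; exact: vn0.
  move=> c _ _ /canonical_copyP[x Cx ->] /canonical_copyP[y Cy ->].
  by rewrite -pi_lin//; apply: copy_pi; exact: vn_lin.
have LT (s : seq (l2 G H)) (e : R[i]) : 0 < e ->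
    exists2 S, canonical_copy alpha C S &
      forall f, f \in s -> `|T f - S f| < e.
  by move=> e0; have [S /LC LS TS] := bicommutant_density s mC CT e0; exists S.
have cT : crossed_matrix T.
  apply: crossed_matrix_closed LT => _ /canonical_copyP[x Cx ->].
  exact: crossed_matrix_pi.
rewrite (diagonal_crossed_matrix cT); first by apply: copy_pi; case: cT.
move=> k k1; apply: bop_ext => v; apply: (@eps_vec_eq0 _ _ _ 1) => // e e0.
have [_ /canonical_copyP[x Cx ->] TS] := LT [:: delta k v] e e0.
rewrite entryE mul1r.
have := TS _ (mem_head _ _) => /(le_lt_trans (l2_norm_ge _ 1%g)) /ltW.
rewrite l2BE pi_delta// [delta _ _ _]deltaE; case: eqP => [k1'|_].
  by case: k1.
by rewrite subr0.
Qed.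

End invariant_algebra.

End covariant_representation.
(** * Automorphisms of the center *)

Section center.
Variables (R : realType) (H : hilbertType R) (N : set (bop H)).
Hypothesis vN : von_neumann N.
Implicit Types (x y z S T : bop H).

Lemma center_comm x y : vn_center N x -> N y -> bopM x y = bopM y x.
Proof. by move=> [_ xN'] Ny; rewrite (xN' y Ny). Qed.

Lemma center_abelian : abelian_algebra (vn_center N).
Proof. by move=> x y Zx [Ny _]; exact: center_comm. Qed.

Lemma center_center : vn_center (vn_center N) = vn_center N.
Proof.
apply/seteqP; split=> [x []//|x Zx]; split=> // y Zy.
exact: center_abelian.
Qed.

Lemma aut_center a : automorphism N a -> automorphism (vn_center N) a.
Proof.
move=> aut; have aN := aut_in aut.
have ZN x : vn_center N x -> N x by case.
split=> [|c x y /ZN Nx /ZN Ny|x y /ZN Nx /ZN Ny|x /ZN Nx].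
- split=> [x Zx|x y|y Zy].
  + split=> [|y Ny]; first exact/aN/ZN.
    have [x' Nx' <-] := aut_surj aut Ny; have Nx := ZN x Zx.
    by rewrite -!(autM aut)// (center_comm Zx).
  + move=> /set_mem/ZN Nx /set_mem/ZN Ny; exact: (aut_inj aut).
  + have [x Nx ax] := aut_surj aut (ZN y Zy); exists x => //; split=> // t Nt.
    apply: (aut_inj aut); [exact: vnM|exact: vnM|].
    by rewrite !(autM aut)// ax (center_comm Zy)//; exact: aN.
- exact: (aut_lin aut).
- exact: (autM aut).
- exact: (aut_adj aut).
Qed.

Lemma act_center (G : groupType) (alpha : G -> bop H -> bop H) :
  group_action alpha N -> group_action alpha (vn_center N).
Proof.
move=> [aut actM]; split=> [g|g h x [Nx _]]; first exact: aut_center.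
exact: actM.
Qed.

(** The central support of [x]: the projection onto the closure of the span of
    [Z' x H], where [Z'] is the commutant of the center. *)
Lemma central_support x : exists p, [/\ vn_center N p, is_projection p,
  bopM p x = x & forall w, vn_center N w -> bopM w x = 0 -> bopM w p = 0].
Proof.
pose Z := vn_center N; have vZ : von_neumann Z by exact: vn_center_vn.
pose sub (X : set H) := X 0 /\
  forall (c : R[i]) k k', X k -> X k' -> X (c *: k + k').
pose K := [set k | forall X, sub X ->
  (forall S v, commutant Z S -> X (S (x v))) -> X k].
have [|c k k' Kk Kk' X sX XS|P KP] := @orthogonal_projection _ _ K.
- by move=> X [].
- have [_ Xlin] := sX; apply: Xlin; [exact: Kk|exact: Kk'].
have [_ PX PK] := KP.
have KS S v : commutant Z S -> K (S (x v)) by move=> ZS X _; apply.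
have SK S : commutant Z S -> forall k, K k -> K (S k).
  move=> ZS k Kk; apply: (Kk [set k | K (S k)]).
  - split=> [|c l l' Kl Kl'] /=; first by rewrite bop0 => X [].
    rewrite bop_linear => X sX XS; have [_ Xlin] := sX.
    by apply: Xlin; [exact: Kl|exact: Kl'].
  - move=> T v ZT /=; rewrite -bopME; apply: KS; exact: commutantM.
have ZP : Z P.
  apply: vn_bicomm => // S ZS; apply: (projection_comm KP).
    exact: SK.
  by apply: SK; apply: commutant_adj => //; exact: vn_adj.
exists P; split=> //.
- by split; [exact: projection_idem KP|exact: adj_projection KP].
- apply: bop_ext => v; rewrite bopME PK// -[x v]bop1E.
  by apply: KS; exact: commutant1.
move=> w Zw wx; apply: bop_ext => y.
have wK k : K k -> w k = 0.
  move=> /(_ [set k | w k = 0]); apply.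
    split=> [|c l l' /= wl wl']; first exact: bop0.
    by rewrite bop_linear wl wl' scaler0 addr0.
  move=> S v ZS /=; rewrite -bopME ZS// bopME -[w (x v)]bopME wx bop0E.
  by rewrite bop0.
have [d d0 wd] := bop_bounded w.
apply: (@eps_vec_eq0 _ _ _ d) => [|e e0]; first exact: ltW.
have [k Kk yk] := PX y e e0.
rewrite bopME -[w (P y)]subr0 -(wK k Kk) -bopB (le_trans (wd _))//.
by rewrite ler_pM2l// ltW.
Qed.

(** The central support [p] of an intertwiner [x] is fixed by [a], and [a] is
    trivial below it: a witness against proper outerness on the center. *)
Lemma center_properly_outer a x : automorphism (vn_center N) a ->
  properly_outer (vn_center N) a -> N x ->
  (forall z, vn_center N z -> bopM z x = bopM x (a z)) -> x = 0.
Proof.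
move=> aut outer Nx xa; apply/eqP/negPn/negP => /eqP x0.
have vZ := vn_center_vn vN.
have [p [Zp pp px psup]] := central_support x.
have zp z : vn_center N z -> bopM z p = bopM (a z) p.
  move=> Zz; have Zaz := aut_in aut Zz.
  apply/subr0_eq; rewrite -bopMBl; apply: psup; first exact: vnB.
  by rewrite bopMBl xa// (center_comm Zaz Nx) subrr.
have ap : a p = p.
  have Zap := aut_in aut Zp; have [z Zz az] := aut_surj aut Zp.
  have zpp : bopM z p = p by rewrite zp// az pp.1.
  have : bopM p (a p) = a p by rewrite -{1}az -(autM aut)// zpp.
  by rewrite -(center_abelian Zap Zp) -zp// pp.1.
apply: outer; exists p; split=> //.
- by rewrite center_center.
- by move=> p0; apply: x0; rewrite -px p0 bop0M.
exists p; rewrite pp.2 pp.1; split=> // z Zz.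
rewrite (autM aut)// ap -zp// -(bopMA z) pp.1 bopMA (center_abelian Zp Zz).
by rewrite -bopMA pp.1.
Qed.

End center.

(** * The crossed product *)

Section crossed_product.
Variables (R : realType) (H : hilbertType R) (G : groupType).
Variables (N : set (bop H)) (alpha : G -> bop H -> bop H).
Hypotheses (vN : von_neumann N) (act : group_action alpha N).
Implicit Types (g h k : G) (v w : H) (x y z n u : bop H).
Implicit Types (S T : bop (l2 G H)).

Let Z := vn_center N.
Let M := crossed_product alpha N.
Let vZ : von_neumann Z. Proof. exact: vn_center_vn. Qed.
Let actZ : group_action alpha Z. Proof. exact: act_center. Qed.
Local Notation piN := (pi alpha).
Let ZN : Z `<=` N. Proof. by move=> z []. Qed.

Lemma pi_in x : N x -> M (piN x).
Proof. by move=> Nx; apply: sub_bicommutant; left; exact: (copy_pi vN act). Qed.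

Lemma lam_in g : M (lam H g).
Proof. by apply: sub_bicommutant; right; exists g; exact: lamE. Qed.

Lemma crossed_product_vn : von_neumann M.
Proof.
apply: bicommutant_vn => T
  [/(canonical_copyP vN act)[x Nx ->]|[g /is_lambdaP ->]].
  by left; rewrite (adj_pi vN act)//; apply: (copy_pi vN act); exact: vn_adj.
by right; exists g^-1%g; rewrite adj_lam; exact: lamE.
Qed.

(** A group of unitaries generating the crossed product; its span replaces the
    algebra of finite sums [\sum_k pi (x_k) lambda_k]. *)
Definition covariant_unitary : set (bop (l2 G H)) := [set T |
  exists u g, [/\ N u, unitary u & T = bopM (piN u) (lam H g)]].

Lemma star_monoid_covariant_unitary : star_monoid covariant_unitary.
Proof.
have N1 := vn1 vN.
split.
- exists (bop1 H), 1%g; split=> //; last by rewrite (pi1 vN act) lam1 bop1M.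
  by split; rewrite adj1 bop1M.
- move=> _ _ [u [g [Nu uu ->]]] [t [h [Nt ut ->]]].
  have Ngt := act_in act g Nt.
  exists (bopM u (alpha g t)), (g * h)%g; split; first exact: vnM.
    have autg := act.1 g.
    have [agt1 agt2] : unitary (alpha g t).
      have Nt' := vn_adj vN Nt.
      split; rewrite -(aut_adj autg)// -(autM autg)// ?ut.1 ?ut.2;
        exact: (aut1 vN autg).
    split; rewrite adjM bopMA.
      by rewrite -(bopMA _ (adj u)) uu.1 bopM1.
    by rewrite -(bopMA u) agt2 bopM1 uu.2.
  by rewrite (piM vN act)// -lamM -!bopMA
    [bopM _ (bopM (piN t) _)]bopMA (lam_pi vN act)// -!bopMA.
- move=> _ [u [g [Nu uu ->]]]; have Nu' := vn_adj vN Nu.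
  have Ngu := act_in act g^-1%g Nu'.
  exists (alpha g^-1%g (adj u)), g^-1%g; split=> //.
    have autg := act.1 g^-1%g.
    split; rewrite -(aut_adj autg)// adjK -(autM autg)// ?uu.1 ?uu.2;
      exact: (aut1 vN autg).
  by rewrite adjM (adj_pi vN act)// adj_lam (lam_pi vN act).
Qed.

Lemma crossed_product_bicommutant :
  M `<=` commutant (commutant covariant_unitary).
Proof.
apply: commutantS => T UT S
  [/(canonical_copyP vN act)[x Nx ->]|[g /is_lambdaP ->]].
- have [_ ] : [set x | N x /\ bopM (piN x) T = bopM T (piN x)] x; last by [].
  have := vn_unitary_span vN Nx; move: x {Nx}; apply: lin_span_ind.
  + split; first exact: vn0.
    by rewrite (pi0 vN act) bop0M bopM0.
  + move=> c x y [Nx xT] [Ny yT]; split; first exact: vn_lin.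
    by rewrite (pi_lin vN act)// bopMDl bopMDr bopMZl bopMZr xT yT.
  + move=> u [Nu uu]; split=> //; have := UT (bopM (piN u) (lam H 1%g)).
    by rewrite lam1 bopM1; apply; exists u, 1%g; rewrite lam1 bopM1.
- apply: UT; exists (bop1 H), g; split; first exact: vn1.
    by split; rewrite adj1 bop1M.
  by rewrite (pi1 vN act) bop1M.
Qed.

Lemma crossed_product_matrix T : M T -> crossed_matrix alpha N T.
Proof.
move=> /crossed_product_bicommutant MT.
apply: (@crossed_matrix_closed _ _ _ _ _ vN act (lin_span covariant_unitary)).
  apply: lin_span_ind.
  - exact: crossed_matrix0.
  - by move=> c S S'; exact: crossed_matrix_lin.
  - move=> _ [u [g [Nu _ ->]]]; exact: crossed_matrix_pi_lam.
move=> s e e0; apply: bicommutant_density => //.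
exact: star_monoid_covariant_unitary.
Qed.

(** Conjugation by [pi u lambda_g] acts on the copy of the center as [alpha g],
    because [u] commutes with the center. *)
Lemma covariant_unitary_normalizes :
  covariant_unitary `<=` groupoid_normalizer M (canonical_copy alpha Z).
Proof.
move=> _ [u [g [Nu uu ->]]]; have Nu' := vn_adj vN Nu.
have MU : M (bopM (piN u) (lam H g)).
  by apply: (vnM crossed_product_vn); [exact: pi_in|exact: lam_in].
have aU : adj (bopM (piN u) (lam H g)) = bopM (lam H g^-1%g) (piN (adj u)).
  by rewrite adjM (adj_pi vN act)// adj_lam.
split=> //.
  rewrite /is_partial_isometry aU -[X in bopM _ X]bopMA.
  rewrite [bopM (piN (adj u)) _]bopMA.
  by rewrite -(piM vN act)// uu.1 (pi1 vN act) bop1M lamM mulVg lam1 bopM1.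
move=> _ /(canonical_copyP vZ actZ)[z Zz ->]; have Nz := ZN Zz.
rewrite aU; split.
  have -> : bopM (bopM (lam H g^-1%g) (piN (adj u)))
      (bopM (piN z) (bopM (piN u) (lam H g))) = piN (alpha g^-1%g z).
    rewrite -!bopMA [bopM (piN z) _]bopMA.
    rewrite -(piM vN act)// (center_comm Zz Nu) (piM vN act)//.
    rewrite !bopMA -[bopM (bopM (lam _ _) _) (piN u)]bopMA -(piM vN act)// uu.1.
    rewrite (pi1 vN act) bopM1 (lam_pi vN act)// -bopMA lamM mulVg lam1 bopM1//.
  by apply: (copy_pi vZ actZ); exact: (act_in actZ).
have -> : bopM (bopM (piN u) (lam H g))
    (bopM (piN z) (bopM (lam H g^-1%g) (piN (adj u)))) = piN (alpha g z).
  have Ngz := act_in act g Nz; have Zgz := act_in actZ g Zz.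
  rewrite -!bopMA [bopM (lam _ g) _]bopMA (lam_pi vN act)//.
  rewrite -bopMA [bopM (lam _ g) _]bopMA lamM mulgV lam1 bop1M.
  rewrite -!(piM vN act)//; last exact: vnM.
  by rewrite (center_comm Zgz Nu') bopMA uu.2 bop1M.
by apply: (copy_pi vZ actZ); exact: (act_in actZ).
Qed.

Lemma crossed_product_regular : regular_in M (canonical_copy alpha Z).
Proof.
move=> T /crossed_product_bicommutant MT.
have := bicommutant_weakstar star_monoid_covariant_unitary MT.
apply: closure_subset; apply: lin_spanS.
exact: covariant_unitary_normalizes.
Qed.

(** ** The conditional expectation on the diagonal *)

Definition expectation T : bop (l2 G H) := piN (entry T 1%g 1%g).

Lemma entry_quad T g v :
  inner (entry T g g v) v = inner (T (delta g v)) (delta g v).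
Proof. by rewrite entryE inner_delta. Qed.

Lemma entry_le S T g : bop_le S T -> bop_le (entry S g g) (entry T g g).
Proof. by move=> /bop_leE ST; apply/bop_leE => v; rewrite !entry_quad. Qed.

Lemma entry11_in T : M T -> N (entry T 1%g 1%g).
Proof. by move=> /crossed_product_matrix[]. Qed.

Lemma expectation_le S T : M S -> M T -> bop_le S T ->
  bop_le (expectation S) (expectation T).
Proof.
move=> MS MT ST; apply: (pi_le vN act); [exact: entry11_in..|exact: entry_le].
Qed.

Lemma expectation_conditional :
  conditional_expectation M (canonical_copy alpha N) expectation.
Proof.
split.
- by move=> T MT; apply: (copy_pi vN act); exact: entry11_in.
- move=> a S T MS MT.
  by rewrite /expectation entry_lin (pi_lin vN act)//; exact: entry11_in.
- move=> T MT T0; apply: (pi_ge0 vN act); first exact: entry11_in.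
  by rewrite -(@entry0 R G H 1%g 1%g); exact: entry_le.
- move=> _ /(canonical_copyP vN act)[x Nx ->].
  by rewrite /expectation (entry_pi11 vN act).
- move=> _ _ T /(canonical_copyP vN act)[x Nx ->]
    /(canonical_copyP vN act)[y Ny ->] MT.
  have NT := entry11_in MT.
  rewrite /expectation -!(piM vN act)//; last exact: vnM.
  congr (piN _); apply: bop_ext => v.
  rewrite entryE !bopE (pi_delta vN act)// (piE vN act)// invg1 !(act_1 act)//.
  by rewrite entryE.
Qed.

(** A supremum in the von Neumann algebra [M] is a strong limit, hence its
    entry at [(1, 1)] is the limit of the corresponding entries. *)
Lemma expectation_normal : normal_map M (canonical_copy alpha N) expectation.
Proof.
move=> A T AM _ dirA [MT AleT Tle].
have [W AW] := monotone_limit dirA AleT.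
have [_ AleW Wle Wlim] := AW.
have WT : T = W.
  apply: bop_le_anti; last exact: Wle.
  apply: Tle => //; exact: (increases_to_in crossed_product_vn AM AW).
rewrite -{}WT in AW AleW Wle Wlim.
have [Ein _ _ _ _] := expectation_conditional.
split; first exact: Ein.
  move=> _ [S AS <-].
  by apply: expectation_le; [exact: AM|exact: MT|exact: AleT].
move=> _ /(canonical_copyP vN act)[u Nu ->] uA.
apply: (pi_le vN act) => //; first exact: entry11_in.
apply/bop_leB0/bop_ge0E => v; apply: (@ge0_eps _ _ `|v|) => // e e0.
have [S AS TS] := Wlim (delta 1%g v) e e0.
exists (inner ((u - entry S 1%g 1%g) v) v).
  apply: (bop_ge0E _).1; apply: (bop_leB0 _ _).1.
  have := @entry_le _ _ 1%g (uA _ (imageP expectation AS)).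
  by rewrite /expectation !(entry_pi11 vN act)//; exact/entry11_in/AM.
rewrite -innerBl !bopBE opprB addrC addrA subrK.
rewrite (le_trans (CauchySchwarz _ _))// mulrC ler_wpM2l// !entryE -l2BE.
rewrite (le_trans (l2_norm_ge _ _))// distrC.
exact/ltW/TS/bop_le_refl.
Qed.

(** [E (T^* T) = 0] means that the column of [T] of index 1 vanishes, and this
    column carries the same coefficients as the row of index 1. *)
Lemma expectation_faithful : faithful_map M expectation.
Proof.
move=> T MT ET; have [NT covT] := crossed_product_matrix MT.
have T1 v : T (delta 1%g v) = 0.
  apply: innerxx_eq0.
  have /(congr1 (fun S => entry S 1%g 1%g)) := ET.
  rewrite /expectation (entry_pi11 vN act) ?entry0; last first.
    apply: entry11_in; apply: (vnM crossed_product_vn) => //.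
    exact: (vn_adj crossed_product_vn).
  move=> /(congr1 (fun S : bop H => inner (S v) v)).
  by rewrite entry_quad bopME -adjPr bop0E inner0l.
have row0 k : entry T 1%g k = 0.
  have autk := act.1 k; have N0 := vn0 vN.
  apply: (aut_inj autk) => //; rewrite (aut0 vN autk).
  have := covT k^-1%g 1%g; rewrite invgK mul1g => <-.
  by apply: bop_ext => v; rewrite entryE T1.
apply: entry_ext => g h; rewrite entry0 covT row0.
exact: (aut0 vN (act.1 _)).
Qed.

(** ** The relative commutant of the center *)

Lemma copy_sub_relative_commutant :
  canonical_copy alpha N `<=` relative_commutant M (canonical_copy alpha Z).
Proof.
move=> _ /(canonical_copyP vN act)[x Nx ->]; split; first exact: pi_in.
move=> _ /(canonical_copyP vZ actZ)[z Zz ->]; have Nz := ZN Zz.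
by rewrite -!(piM vN act)// (center_comm Zz Nx).
Qed.

(** If [T] commutes with the copy of the center, its entry at [(1, k)]
    intertwines the identity and [alpha k^-1] on the center, so it vanishes
    for [k <> 1]. *)
Lemma relative_commutant_sub :
  (forall g, g <> 1%g -> properly_outer Z (alpha g)) ->
  relative_commutant M (canonical_copy alpha Z) `<=` canonical_copy alpha N.
Proof.
move=> outer T [MT ZT]; have cT := crossed_product_matrix MT.
rewrite (diagonal_crossed_matrix vN act cT).
  by apply: (copy_pi vN act); exact: entry11_in.
move=> k k1; have k1' : k^-1%g <> 1%g.
  by move=> /eqP; rewrite invg_eq1 => /eqP.
apply: (center_properly_outer vN (actZ.1 k^-1%g) (outer _ k1') (cT.1 k)).
move=> z Zz; have Nz := ZN Zz; apply: bop_ext => v.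
have := ZT _ (copy_pi vZ actZ Zz).
move=> /(congr1 (fun S : bop (l2 G H) => S (delta k v) 1%g)).
rewrite !bopME (piE vN act)// (pi_delta vN act)// invg1 (act_1 act)//.
by rewrite !entryE.
Qed.

(** If [alpha g] is trivial on the corner of the center at [p], then
    [pi p lambda_g] commutes with the copy of the center, off the diagonal. *)
Lemma relative_commutant_outer g :
  canonical_copy alpha N = relative_commutant M (canonical_copy alpha Z) ->
  g <> 1%g -> properly_outer Z (alpha g).
Proof.
move=> NE g1 [p [[Zp _] [pp ap] p0 [u [Zu uu1 uu2 upi]]]].
have Np := ZN Zp; have vnZ1 := vn1 vZ.
have inn z : Z z -> alpha g (bopM z p) = bopM z p.
  move=> Zz; rewrite upi//.
  have Zzp : Z (bopM z p) by exact: vnM.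
  by rewrite bopMA (center_comm Zu (ZN Zzp)) -bopMA uu2 -bopMA pp.
have gp : alpha g p = p by have := inn _ vnZ1; rewrite bop1M.
have : canonical_copy alpha N (bopM (piN p) (lam H g)).
  rewrite NE; split.
    by apply: (vnM crossed_product_vn); [exact: pi_in|exact: lam_in].
  move=> _ /(canonical_copyP vZ actZ)[z Zz ->].
  have Nz := ZN Zz; have Ngz := act_in act g Nz.
  rewrite bopMA -(piM vN act)// -[RHS]bopMA (lam_pi vN act)// bopMA.
  rewrite -(piM vN act)//; congr (bopM (piN _) _).
  by rewrite -{2}gp -(autM (act.1 g))// (center_comm Zp Nz) inn.
move=> /(canonical_copyP vN act)[n Nn /(congr1 (fun S => entry S 1%g g^-1%g))].
rewrite (entry_pi_lam vN act)// mulgV eqxx invg1 (act_1 act)//.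
rewrite (entry_pi vN act)//; case: eqP => [/esym/eqP|_]; last exact: p0.
by rewrite invg_eq1 => /eqP.
Qed.

End crossed_product.

Theorem theorem6p3 (R : realType) (H : hilbertType R) (G : groupType)
    (N : set (bop H)) (alpha : G -> bop H -> bop H) :
  von_neumann N ->
  group_action alpha N ->
  (forall g : G, g <> 1%g -> properly_outer N (alpha g)) ->
  (cartan_triple (crossed_product alpha N) (canonical_copy alpha N)
     (canonical_copy alpha (vn_center N))
   <-> forall g : G, g <> 1%g -> properly_outer (vn_center N) (alpha g)).
Proof.
move=> vN act _; split=> [[_ _ NE _] g g1|outer].
  exact: (relative_commutant_outer vN act NE g1).
have vZ := vn_center_vn vN; have actZ := act_center vN act.
split.
- split; first exact: crossed_product_vn.
    exact: copy_vn.
  exact: copy_vn.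
- split; last exact: crossed_product_regular.
    move=> _ /(canonical_copyP vZ actZ)[z [Nz _] ->].
    exact: pi_in.
  move=> _ _ /(canonical_copyP vZ actZ)[y Zy ->]
    /(canonical_copyP vZ actZ)[z Zz ->].
  by rewrite -!(piM vZ actZ)// (center_abelian Zy Zz).
- apply/seteqP; split; first exact: copy_sub_relative_commutant.
  exact: relative_commutant_sub.
exists (expectation alpha); split.
- exact: expectation_conditional.
- exact: expectation_normal.
- exact: expectation_faithful.
Qed.
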